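(* Let $H$ be a semisimple Hopf algebra over an algebraically closed field $K$ of characteristic zero, and let $V$ be a finite-dimensional $H$-module. Let $J$ be the intersection of the annihilators in $H$ of all tensor powers $V^{\otimes m}$, $m\ge 0$, which is a Hopf ideal of $H$, and let $$G_V:=\{g\in G(H/J) \mid \exists\,\xi\in K\ \forall\, v\in V:\ g.v=\xi v\}.$$ Let $A$ be the matrix representing left multiplication by the character of $V$, considered as an $H/J$-module, on the character ring $\operatorname{Ch}(H/J)$ with respect to the basis consisting of the irreducible characters of $H/J$. Then the group $G_V$ is cyclic and contained in the center $Z(H/J)$ of $H/J$. Its order is equal to the index of imprimitivity of $A$: $$\operatorname{ind}(A)=|G_V|.$$
   Context: A semisimple Hopf algebra is finite-dimensional. Modules are left modules; tensor powers carry the diagonal action, and $V^{\otimes 0}=K$ is the trivial module. $J$ is the largest Hopf ideal contained in the annihilator of $V$, so $V$ is a module over the quotient Hopf algebra $H/J$. $G(H/J)$ is the group of grouplike elements of $H/J$. For a semisimple Hopf algebra $L$ over $K$, the character ring $\operatorname{Ch}(L)$ is the subalgebra of the dual algebra $L^*$ (with convolution product) spanned over $K$ by the irreducible characters $\chi_1,\ldots,\chi_k$ of $L$, which form a basis of it; the matrix $A=(a_{ij})$ of left multiplication by a character $\chi$ is determined by $\chi\chi_j=\sum_i a_{ij}\chi_i$ and has nonnegative integer entries. The matrix $A$ in the claim is indecomposable (i.e. there is no partition of the index set into nonempty disjoint sets $M,N$ with $a_{ij}=0$ for all $i\in M,j\in N$). Its Perron-Frobenius eigenvalue $\lambda$ is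 the nonnegative real eigenvalue satisfying $|\mu|\le\lambda$ for all complex eigenvalues $\mu$ of $A$ (here $\lambda=\dim V$). The index of imprimitivity is $\operatorname{ind}(A):=|\{\mu\in\mathbb{C} \mid \mu \text{ is an eigenvalue of } A \text{ with } |\mu|=\lambda\}|$. *)

(* Defs.v *)
From HB Require Import structures.
From mathcomp Require Import all_boot all_order all_algebra all_field.
From mathcomp Require Import finmap mathcomp_extra boolp classical_sets.
From mathcomp Require Import functions cardinality reals complex.
Set Implicit Arguments.
Unset Strict Implicit.
Unset Printing Implicit Defensive.
Import Order.TTheory GRing.Theory Num.Theory.
Local Open Scope ring_scope.

Section Tensor.
Variable K : fieldType.
Implicit Types U W X Y Z : vectType K.

Definition bilin U W X (f : U -> W -> X) : Prop :=
  (forall w, linear (f^~ w)) /\ (forall u, linear (f u)).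

(* [tensor U W] is a model of the tensor product of U and W: a tensor is the  *)
(* matrix of its coordinates in the basis of the tensors [tens u w], u and w  *)
(* ranging over the bases [vbasis {:U}] and [vbasis {:W}].                    *)
Definition tensor U W := 'M[K]_(\dim {:U}, \dim {:W}).
HB.instance Definition _ U W := Vector.on (tensor U W).

Definition tens U W (u : U) (w : W) : tensor U W :=
  \matrix_(i, j) (coord (vbasis {:U}) i u * coord (vbasis {:W}) j w).

(* The linear map on the tensor product induced by a bilinear map f; thus     *)
(* [tlift (fun a1 a2 => E) (comul a)] is E in Sweedler notation.              *)
Definition tlift U W X (f : U -> W -> X) (t : tensor U W) : X :=
  \sum_i \sum_j t i j *: f (vbasis {:U})`_i (vbasis {:W})`_j.

Definition tmap U W U' W' (f : U -> U') (g : W -> W') (t : tensor U W) :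
  tensor U' W' := tlift (fun u w => tens (f u) (g w)) t.

(* The image of the tensor product of P and Q in that of U and W. *)
Definition tens_vs U W (P : {vspace U}) (Q : {vspace W}) :
    {vspace tensor U W} :=
  <<[seq tens u w | u <- vbasis P, w <- vbasis Q]>>%VS.

Lemma tlift_linear U W X (f : U -> W -> X) : linear (tlift f).
Proof.
move=> a s t; rewrite /tlift scaler_sumr -big_split; apply: eq_bigr => i _ /=.
rewrite scaler_sumr -big_split; apply: eq_bigr => j _ /=.
by rewrite !mxE scalerDl scalerA.
Qed.

HB.instance Definition _ U W X (f : U -> W -> X) :=
  GRing.isLinear.Build K (tensor U W) X _ (tlift f) (tlift_linear f).

Lemma eq_tlift U W X (f g : U -> W -> X) t :
  (forall u w, f u w = g u w) -> tlift f t = tlift g t.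
Proof. by move=> e; apply: eq_bigr => i _; apply: eq_bigr => j _; rewrite e. Qed.

Lemma linear_comb U X (f : U -> X) (n : nat) (a : 'I_n -> K) (u : 'I_n -> U) :
  linear f -> f (\sum_i a i *: u i) = \sum_i a i *: f (u i).
Proof.
move=> lf; have f0 : f 0 = 0.
  by have := lf (-1) 0 0; rewrite scaler0 add0r scaleN1r addNr.
elim/big_rec2: _ => [|i y x _ <-]; first exact: f0.
by rewrite lf.
Qed.

Lemma tlift_comp U W X Y (g : X -> Y) (f : U -> W -> X) t :
  linear g -> g (tlift f t) = tlift (fun u w => g (f u w)) t.
Proof.
move=> lg; rewrite /tlift.
rewrite (eq_bigr (fun i => 1 *: \sum_j t i j *: f (vbasis {:U})`_i (vbasis {:W})`_j));
  last by move=> i _; rewrite scale1r.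
rewrite linear_comb //; apply: eq_bigr => i _.
by rewrite scale1r linear_comb.
Qed.

Lemma tens_bilin U W : bilin (@tens U W).
Proof.
split=> [w|u] a x y; apply/matrixP=> i j; rewrite !mxE linearP /=.
  by rewrite mulrDl mulrA.
by rewrite mulrDr mulrCA.
Qed.

Lemma bilin_sum U W X (f : U -> W -> X) (m n : nat) (a : 'I_m -> K) (b : 'I_n -> K)
  (u : 'I_m -> U) (w : 'I_n -> W) : bilin f ->
  f (\sum_i a i *: u i) (\sum_j b j *: w j) =
  \sum_i \sum_j (a i * b j) *: f (u i) (w j).
Proof.
case=> fl fr; rewrite (linear_comb _ _ (fl _)); apply: eq_bigr => i _.
rewrite linear_comb // scaler_sumr; apply: eq_bigr => j _.
by rewrite scalerA.
Qed.

Lemma tlift_tens U W X (f : U -> W -> X) u w :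
  bilin f -> tlift f (tens u w) = f u w.
Proof.
move=> bf; rewrite [in RHS](coord_vbasis (memvf u)) [in RHS](coord_vbasis (memvf w)).
rewrite bilin_sum //; apply: eq_bigr => i _; apply: eq_bigr => j _.
by rewrite mxE.
Qed.

Lemma tlift_id U W (t : tensor U W) : tlift (@tens U W) t = t.
Proof.
rewrite [RHS]matrix_sum_delta; apply: eq_bigr => i _; apply: eq_bigr => j _.
congr (_ *: _); apply/matrixP=> i' j'; rewrite !mxE.
rewrite !coord_free ?(basis_free (vbasisP _)) //.
by rewrite eq_sym [_ == j]eq_sym; do 2!case: eqP => //= _; rewrite ?mulr1 ?mulr0.
Qed.

Lemma tlift_tlift U W X Y Z (g : X -> Y -> Z) (f : U -> W -> tensor X Y) t :
  tlift g (tlift f t) = tlift (fun u w => tlift g (f u w)) t.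
Proof. exact/tlift_comp/tlift_linear. Qed.

Lemma tlift_tmap U W U' W' X (f : U' -> W' -> X) (g : U -> U') (h : W -> W') t :
  bilin f -> tlift f (tmap g h t) = tlift (fun u w => f (g u) (h w)) t.
Proof. by move=> bf; rewrite tlift_tlift; apply: eq_tlift => u w; exact: tlift_tens. Qed.

Lemma bilin_comp U W U' W' X (f : U -> W -> X) (g : U' -> U) (h : W' -> W) :
  bilin f -> linear g -> linear h -> bilin (fun u w => f (g u) (h w)).
Proof.
by case=> fl fr lg lh; split=> [w|u] a x y; rewrite ?lg ?lh ?fl ?fr.
Qed.

Lemma tlift_bilin U W X Y Z (F : Y -> Z -> U -> W -> X) t :
  (forall u w, bilin (fun y z => F y z u w)) ->
  bilin (fun y z => tlift (F y z) t).
Proof.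
move=> bF; split=> [z|y] a x x'; rewrite /tlift scaler_sumr -big_split;
  apply: eq_bigr => i _ /=; rewrite scaler_sumr -big_split;
  apply: eq_bigr => j _ /=; rewrite ?(bF _ _).1 ?(bF _ _).2;
  by rewrite scalerDr !scalerA mulrC.
Qed.

Lemma tmap_linear U W U' W' (f : U -> U') (g : W -> W') : linear (tmap f g).
Proof. exact: tlift_linear. Qed.

Lemma tens_in_vs U W (P : {vspace U}) (Q : {vspace W}) u w :
  u \in P -> w \in Q -> tens u w \in tens_vs P Q.
Proof.
move=> uP wQ; rewrite (coord_vbasis uP) (coord_vbasis wQ).
rewrite (bilin_sum _ _ _ _ (@tens_bilin U W)).
apply: memv_suml => i _; apply: memv_suml => j _; apply: memvZ.
by apply: memv_span; apply: allpairs_f; apply: mem_nth; rewrite size_tuple.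
Qed.

Lemma tens_vs_ker U W X (f : U -> W -> X) (P : {vspace U}) (Q : {vspace W}) t :
  bilin f -> (forall u w, u \in P -> w \in Q -> f u w = 0) ->
  t \in tens_vs P Q -> tlift f t = 0.
Proof.
move=> bf f0 tPQ; rewrite -[LHS](lfunE (tlift f)).
apply/eqP; rewrite -memv_ker; apply: (subvP _ _ tPQ).
apply/span_subvP => _ /allpairsP[[u w] /= [uP wQ ->]].
by rewrite memv_ker lfunE /= tlift_tens // f0 ?(vbasis_mem uP) ?(vbasis_mem wQ).
Qed.

End Tensor.

HB.mixin Record Falgebra_isHopf (K : fieldType) H of Falgebra K H := {
  comul : H -> tensor H H;
  counit : H -> K;
  antipode : H -> H;
  comul_linear : linear comul;
  counit_scalar : scalar counit;
  antipode_linear : linear antipode;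
  comul1 : comul 1 = tens 1 1;
  comulM : forall a b, comul (a * b) =
    tlift (fun a1 a2 =>
      tlift (fun b1 b2 => tens (a1 * b1) (a2 * b2)) (comul b)) (comul a);
  counit1 : counit 1 = 1;
  counitM : {morph counit : a b / a * b};
  comulA : forall a,
    tlift (fun a1 a2 =>
      tlift (fun a11 a12 => tens a11 (tens a12 a2)) (comul a1)) (comul a) =
    tlift (fun a1 a2 => tens a1 (comul a2)) (comul a);
  counit_comull : forall a, tlift (fun a1 a2 => counit a1 *: a2) (comul a) = a;
  counit_comulr : forall a, tlift (fun a1 a2 => counit a2 *: a1) (comul a) = a;
  antipodel : forall a,
    tlift (fun a1 a2 => antipode a1 * a2) (comul a) = counit a *: 1;
  antipoder : forall a,
    tlift (fun a1 a2 => a1 * antipode a2) (comul a) = counit a *: 1;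
}.

#[short(type="hopfAlgType")]
HB.structure Definition HopfAlgebra (K : fieldType) :=
  { H of Falgebra_isHopf K H & Falgebra K H }.

Section Modules.
Variable K : fieldType.

Record hmodule (A : falgType K) := HModule {
  carrier :> vectType K;
  hact : A -> carrier -> carrier;
  hact_bilin : bilin hact;
  hact1 : forall v, hact 1 v = v;
  hactM : forall a b v, hact (a * b) v = hact a (hact b v)
}.

Definition submodule (A : falgType K) (M : hmodule A) (U : {vspace M}) : Prop :=
  forall a u, u \in U -> hact a u \in U.

Definition simple_module (A : falgType K) (M : hmodule A) : Prop :=
  {:M}%VS <> 0%VS /\
  forall U : {vspace M}, submodule U -> U = 0%VS \/ U = {:M}%VS.

Definition semisimple_module (A : falgType K) (M : hmodule A) : Prop :=
  forall U : {vspace M}, submodule U ->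
  exists2 U' : {vspace M}, submodule U' & (U + U' = {:M})%VS /\ (U :&: U' = 0)%VS.

Lemma mul_bilin (A : falgType K) : bilin ( *%R : A -> A -> A).
Proof.
by split=> [w|u] a x y; rewrite ?mulrDl ?mulrDr -?scalerAl -?scalerAr.
Qed.

Definition regular_module (A : falgType K) : hmodule A :=
  @HModule A A *%R (@mul_bilin A) (@mul1r A) (fun a b v => esym (mulrA a b v)).

Definition semisimple_algebra (A : falgType K) : Prop :=
  semisimple_module (regular_module A).

Definition character (A : falgType K) (M : hmodule A) : 'Hom(A, K^o) :=
  linfun (fun a : A =>
    \sum_i coord (vbasis {:M}) i (hact a (vbasis {:M})`_i) : K^o).

Lemma characterE (A : falgType K) (M : hmodule A) a : character M a =
  \sum_i coord (vbasis {:M}) i (hact a (vbasis {:M})`_i).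
Proof.
rewrite /character; set f := (fun a : A => _ : K^o).
have lf : linear f.
  move=> c x y; rewrite /f /= scaler_sumr -big_split; apply: eq_bigr => i _.
  by rewrite (hact_bilin M).1 linearP.
pose g := HB.pack_for {linear A -> K^o} f (GRing.isLinear.Build K A K^o _ f lf).
by rewrite -[f]/(g : A -> K^o) lfunE.
Qed.

End Modules.

Section HopfModules.
Variables (K : fieldType) (H : hopfAlgType K).

Lemma trivial_bilin : bilin (fun (a : H) (x : K^o) => counit a *: x).
Proof.
split=> [w|u] a x y; first by rewrite counit_scalar scalerDl scalerA.
by rewrite scalerDr !scalerA mulrC.
Qed.

Lemma trivial_act1 (x : K^o) : counit (1 : H) *: x = x.
Proof. by rewrite counit1 scale1r. Qed.

Lemma trivial_actM (a b : H) (x : K^o) :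
  counit (a * b) *: x = counit a *: (counit b *: x).
Proof. by rewrite counitM scalerA. Qed.

Definition trivial_module : hmodule H :=
  HModule trivial_bilin trivial_act1 trivial_actM.

Section TensorModule.
Variables V W : hmodule H.

Definition tens_act (a : H) (t : tensor V W) : tensor V W :=
  tlift (fun a1 a2 => tmap (@hact _ _ V a1) (@hact _ _ W a2) t) (comul a).

Let tmap_hact_bilin t :
  bilin (fun a1 a2 : H => tmap (@hact _ _ V a1) (@hact _ _ W a2) t).
Proof.
apply: tlift_bilin => u w.
apply: bilin_comp (@tens_bilin K V W) _ _; exact: (hact_bilin _).1.
Qed.

Lemma tens_act_bilin : bilin tens_act.
Proof.
split=> [t|a] c x y; rewrite /tens_act; first by rewrite comul_linear linearP.
rewrite /tlift scaler_sumr -big_split; apply: eq_bigr => i _ /=.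
rewrite scaler_sumr -big_split; apply: eq_bigr => j _ /=.
by rewrite tmap_linear scalerDr !scalerA mulrC.
Qed.

Lemma tens_act1 t : tens_act 1 t = t.
Proof.
rewrite /tens_act comul1 tlift_tens //.
by rewrite -[RHS]tlift_id; apply: eq_tlift => u w; rewrite !hact1.
Qed.

Lemma tens_actM a b t : tens_act (a * b) t = tens_act a (tens_act b t).
Proof.
rewrite /tens_act comulM tlift_tlift; apply: eq_tlift => a1 a2.
rewrite tlift_tlift [RHS]tlift_comp; last exact: tmap_linear.
apply: eq_tlift => b1 b2; rewrite tlift_tens // [RHS]tlift_tmap.
  by apply: eq_tlift => u w; rewrite !hactM.
apply: bilin_comp (@tens_bilin K V W) _ _; exact: (hact_bilin _).2.
Qed.

Definition tensor_module : hmodule H :=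
  HModule tens_act_bilin tens_act1 tens_actM.

End TensorModule.

Fixpoint tensor_power (V : hmodule H) (m : nat) : hmodule H :=
  if m is m'.+1 then tensor_module V (tensor_power V m') else trivial_module.

(* The intersection of the annihilators of all tensor powers of V; see        *)
(* [tpow_annP] for the membership characterization.                           *)
Definition tpow_ann (V : hmodule H) : {vspace H} :=
  xget 0%VS [set J : {vspace H} | forall x : H,
    x \in J <-> forall m (t : tensor_power V m), hact x t = 0].

Lemma vspace_of_pred (vT : vectType K) (P : vT -> Prop) :
  P 0 -> (forall c x y, P x -> P y -> P (c *: x + y)) ->
  exists U : {vspace vT}, forall x, x \in U <-> P x.
Proof.
move=> P0 Plin.
pose Q n := `[< exists2 U : {vspace vT}, \dim U = n & forall x, x \in U -> P x >].
have exQ : exists n, Q n.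
  exists 0%N; apply/asboolP; exists 0%VS; first by rewrite dimv0.
  by move=> x; rewrite memv0 => /eqP ->.
have ubQ n : Q n -> (n <= \dim {:vT})%N.
  by move=> /asboolP[U <- _]; apply/dimvS/subvf.
case: (ex_maxnP exQ ubQ) => n /asboolP[U dU UP] nmax; exists U => x.
split=> [/UP //|Px]; apply: contrapT => /negP xU.
have: (\dim (<[x]> + U) <= n)%N.
  apply: nmax; apply/asboolP; exists (<[x]> + U)%VS => // y.
  by case/memv_addP => _ /vlineP[c ->] [u /UP Pu ->]; exact: Plin.
rewrite -dU leqNgt => /negP; apply.
rewrite ltn_neqAle dimvS ?addvSr // andbT.
apply: contraNneq xU => eqd.
have : (U == <[x]> + U)%VS by rewrite eqEdim addvSr -eqd leqnn.
by move/eqP=> ->; apply: (subvP (addvSl _ _)); exact: memv_line.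
Qed.

Lemma hact0 (M : hmodule H) (v : M) : hact (0 : H) v = 0.
Proof. by have := (hact_bilin M).1 v (-1) 0 0; rewrite scaler0 add0r scaleN1r addNr. Qed.

Lemma tpow_annP (V : hmodule H) (x : H) :
  x \in tpow_ann V <-> forall m (t : tensor_power V m), hact x t = 0.
Proof.
rewrite /tpow_ann; case: xgetP => [U _ /(_ x) //|none]; exfalso.
have [||U UP] := @vspace_of_pred _
    (fun y : H => forall m (t : tensor_power V m), hact y t = 0).
- by move=> m t; exact: hact0.
- move=> c y z hy hz m t.
  by rewrite (hact_bilin (tensor_power V m)).1 hy hz scaler0 addr0.
by apply: (none U).
Qed.

Lemma tpow_ann_act (V : hmodule H) (x : H) (v : V) :
  x \in tpow_ann V -> hact x v = 0.
Proof.
move=> /tpow_annP/(_ 1%N (tens v (1 : K^o))) /=; rewrite /tens_act.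
have bt := @tens_bilin K V K^o.
have E a1 a2 : tmap (@hact _ _ V a1) (@hact _ _ trivial_module a2)
     (tens v (1 : K^o)) = tens (counit a2 *: hact a1 v) (1 : K^o).
  rewrite [LHS]tlift_tens; last first.
    apply: bilin_comp bt _ _; first exact: (hact_bilin V).2.
    exact: (hact_bilin trivial_module).2.
  have lZ c (u : V) (w : K^o) : tens (c *: u) w = c *: tens u w.
    by apply/matrixP=> i j; rewrite !mxE linearZ mulrA.
  have rZ c (u : V) (w : K^o) : tens u (c *: w) = c *: tens u w.
    by apply/matrixP=> i j; rewrite !mxE linearZ mulrCA.
  by rewrite /= lZ rZ.
rewrite (eq_tlift _ E) => e0.
pose F (u : V) (k : K^o) : V := (k : K) *: u.
have bF : bilin F.
  split=> [w|u] a y z; rewrite /F; first by rewrite scalerDr !scalerA mulrC.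
  by rewrite scalerDl scalerA.
have := congr1 (tlift F) e0; rewrite linear0 tlift_tlift => <-.
rewrite -[in LHS](counit_comulr x).
have lv : linear (fun a : H => hact a v) by exact: (hact_bilin V).1.
rewrite (tlift_comp _ _ lv); apply: eq_tlift => a1 a2.
rewrite tlift_tens // /F scale1r -[in LHS](addr0 (_ *: _)) lv.
by rewrite hact0 addr0.
Qed.

Definition grouplike (g : H) : Prop := comul g = tens g g /\ counit g = 1.

Definition scalar_grouplikes (M : hmodule H) : set H :=
  [set g : H | grouplike g /\
     exists xi : K, forall v : M, hact g v = xi *: v].

(* The product of the dual algebra *)
Definition conv (f g : 'Hom(H, K^o)) : 'Hom(H, K^o) :=
  linfun (fun a : H => tlift (fun a1 a2 => f a1 * g a2 : K^o) (comul a)).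

Lemma convE f g a : conv f g a = tlift (fun a1 a2 => f a1 * g a2 : K^o) (comul a).
Proof.
rewrite /conv; set F := (fun a : H => _).
have lF : linear F by move=> c x y; rewrite /F comul_linear linearP.
pose G := HB.pack_for {linear H -> K^o} F (GRing.isLinear.Build K H K^o _ F lF).
by rewrite -[F]/(G : H -> K^o) lfunE.
Qed.

(* A duplicate-free list of the irreducible characters of H. There are        *)
(* finitely many of them ([fset_set] of an infinite set would be empty).      *)
Definition irr_chars : seq 'Hom(H, K^o) :=
  fset_set [set f : 'Hom(H, K^o) |
    exists2 M : hmodule H, simple_module M & f = character M].

Definition char_ring : {vspace 'Hom(H, K^o)} := <<irr_chars>>%VS.

(* The j-th column of A holds the coordinates of the product of f and chi_j.  *)
Definition lmul_matrix k (f : 'Hom(H, K^o)) (chi : k.-tuple 'Hom(H, K^o))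
    (A : 'M[nat]_k) : Prop :=
  forall j, conv f (tnth chi j) = \sum_i (A i j)%:R *: tnth chi i.

Definition hopf_ideal (J : {vspace H}) : Prop :=
  [/\ forall a x : H, x \in J -> a * x \in J /\ x * a \in J,
      forall x : H, x \in J ->
        comul x \in (tens_vs J {:H} + tens_vs {:H} J)%VS,
      forall x : H, x \in J -> counit x = 0
    & forall x : H, x \in J -> antipode x \in J].

End HopfModules.

Section Quotient.
Variables (K : fieldType) (H : hopfAlgType K) (J : {vspace H}).

(* The quotient Hopf algebra H / J, each class being represented by its       *)
(* unique element in the chosen complement of J.                              *)
Definition hquot of hopf_ideal J : Type := subvs_of (J^C)%VS.

Hypothesis hJ : hopf_ideal J.
Local Notation L := (hquot hJ).

HB.instance Definition _ := Vector.on L.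

Definition hpi (x : H) : L := vsproj (J^C)%VS (x - projv J x).
Definition hrep (q : L) : H := vsval q.

Lemma hpi_linear : linear hpi.
Proof.
move=> c x y; rewrite /hpi -linearP; congr (vsproj _ _).
by rewrite linearP /= opprD addrACA scalerBr.
Qed.
HB.instance Definition _ := GRing.isLinear.Build K H L _ hpi hpi_linear.

Lemma hrep_linear : linear hrep.
Proof. by move=> c x y. Qed.
HB.instance Definition _ := GRing.isLinear.Build K L H _ hrep hrep_linear.

Lemma hrepK : cancel hrep hpi.
Proof.
move=> q; rewrite /hpi /hrep.
suff -> : projv J (vsval q) = 0 by rewrite subr0; exact: vsvalK.
have h0 : vsval q = projv J (vsval q) + (vsval q - projv J (vsval q)) by rewrite addrC subrK.
have: projv J (vsval q) \in (J :&: J^C)%VS.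
  rewrite memv_cap memv_proj -[X in X \in _](subKr (vsval q)) rpredB ?subvsP //.
  exact: memv_projC.
by rewrite capv_compl memv0 => /eqP.
Qed.

Lemma hpiK x : hrep (hpi x) - x \in J.
Proof.
by rewrite /hrep /hpi vsprojK ?memv_projC // addrAC subrr sub0r rpredN memv_proj.
Qed.

Lemma hpi0 x : x \in J -> hpi x = 0.
Proof. by move=> xJ; rewrite /hpi projv_id // subrr linear0. Qed.

Lemma hpi_eq0 x : (hpi x == 0) = (x \in J).
Proof.
apply/eqP/idP => [e0|]; last exact: hpi0.
by have := hpiK x; rewrite e0 linear0 sub0r rpredN.
Qed.

Lemma hpi_eq x y : x - y \in J -> hpi x = hpi y.
Proof. by move=> /hpi0 /eqP; rewrite linearB /= subr_eq0 => /eqP. Qed.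

Definition hq_mul (p q : L) : L := hpi (hrep p * hrep q).

Lemma hpiM x y : hpi (x * y) = hq_mul (hpi x) (hpi y).
Proof.
apply/esym/hpi_eq; have [ideal _ _ _] := hJ.
rewrite -[X in X - _](subrK (x * hrep (hpi y))) -addrA -mulrBl -mulrBr.
by apply: rpredD; [case: (ideal (hrep (hpi y)) _ (hpiK x))
                  |case: (ideal x _ (hpiK y))].
Qed.

Lemma hpi_surj q : exists x, q = hpi x. Proof. by exists (hrep q); rewrite hrepK. Qed.

Lemma hq_mulA : associative hq_mul.
Proof.
move=> p q r; have [[x ->] [[y ->] [z ->]]] := (hpi_surj p, (hpi_surj q, hpi_surj r)).
by rewrite -!hpiM mulrA.
Qed.
Lemma hq_mul1 : left_id (hpi 1) hq_mul.
Proof. by move=> q; have [x ->] := hpi_surj q; rewrite -hpiM mul1r. Qed.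
Lemma hq_mulr1 : right_id (hpi 1) hq_mul.
Proof. by move=> q; have [x ->] := hpi_surj q; rewrite -hpiM mulr1. Qed.
Lemma hq_mulDl : left_distributive hq_mul +%R.
Proof. by move=> p q r; rewrite /hq_mul linearD mulrDl linearD. Qed.
Lemma hq_mulDr : right_distributive hq_mul +%R.
Proof. by move=> p q r; rewrite /hq_mul [hrep (_ + _)]linearD mulrDr linearD. Qed.
Lemma hq_one_neq0 : hpi 1 != 0.
Proof.
rewrite hpi_eq0; apply/negP => J1; have [_ _ /(_ _ J1) e _] := hJ.
by move/eqP: e; rewrite counit1 oner_eq0.
Qed.

HB.instance Definition _ := GRing.Zmodule_isNzRing.Build L
  hq_mulA hq_mul1 hq_mulr1 hq_mulDl hq_mulDr hq_one_neq0.

Lemma hq_scalerAl (a : K) (u v : L) : a *: (u * v) = (a *: u) * v.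
Proof.
by rewrite -[u * v]/(hq_mul _ _) -[RHS]/(hq_mul _ _) /hq_mul -linearZ [hrep (_ *: _)]linearZ -scalerAl.
Qed.
HB.instance Definition _ := GRing.Lmodule_isLalgebra.Build K L hq_scalerAl.

Lemma hq_scalerAr (a : K) (u v : L) : a *: (u * v) = u * (a *: v).
Proof.
by rewrite -[u * v]/(hq_mul _ _) -[RHS]/(hq_mul _ _) /hq_mul -linearZ [hrep (_ *: _)]linearZ -scalerAr.
Qed.
HB.instance Definition _ := GRing.Lalgebra_isAlgebra.Build K L hq_scalerAr.
HB.instance Definition _ := Algebra_isFalgebra.Build K L.

Definition hq_comul (q : L) : tensor L L := tmap hpi hpi (comul (hrep q)).
Definition hq_counit (q : L) : K := counit (hrep q).
Definition hq_antipode (q : L) : L := hpi (antipode (hrep q)).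

Let piD := hpi_linear.
Let piM x y : hpi (x * y) = hpi x * hpi y. Proof. exact: hpiM. Qed.

Lemma hq_comul_pi x : hq_comul (hpi x) = tmap hpi hpi (comul x).
Proof.
rewrite /hq_comul; have [_ coideal _ _] := hJ.
have := coideal _ (hpiK x); rewrite -scaleN1r addrC comul_linear scaleN1r.
case/memv_addP => t1 t1J [t2 t2J e].
have bp : bilin (fun u w : H => tens (hpi u) (hpi w)).
  exact: bilin_comp (@tens_bilin K L L) piD piD.
have bt := @tens_bilin K L L.
have t0l (w : L) : tens (0 : L) w = 0.
  by apply/matrixP=> i j; rewrite !mxE linear0 mul0r.
have t0r (w : L) : tens w (0 : L) = 0.
  by apply/matrixP=> i j; rewrite !mxE linear0 mulr0.
have /(congr1 (tmap hpi hpi)) := e.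
have -> : tmap hpi hpi (t1 + t2) = 0.
  rewrite /tmap linearD /= (tens_vs_ker bp _ t1J) ?(tens_vs_ker bp _ t2J) ?addr0 //.
    by move=> u w _ /hpi0 ->.
  by move=> u w /hpi0 ->.
by rewrite /tmap linearD linearN /= addrC => /subr0_eq.
Qed.

Lemma hq_counit_pi x : hq_counit (hpi x) = counit x.
Proof.
have [_ _ e _] := hJ; have := e _ (hpiK x).
by rewrite -scaleN1r addrC counit_scalar mulN1r addrC => /subr0_eq.
Qed.

Lemma hq_antipode_pi x : hq_antipode (hpi x) = hpi (antipode x).
Proof.
have [_ _ _ e] := hJ; apply: hpi_eq; have := e _ (hpiK x).
by rewrite -scaleN1r addrC antipode_linear scaleN1r addrC.
Qed.

Lemma hq_comul_linear : linear hq_comul.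
Proof. by move=> c x y; rewrite /hq_comul linearP comul_linear tmap_linear. Qed.
Lemma hq_counit_scalar : scalar hq_counit.
Proof. by move=> c x y; rewrite /hq_counit linearP counit_scalar. Qed.
Lemma hq_antipode_linear : linear hq_antipode.
Proof. by move=> c x y; rewrite /hq_antipode linearP antipode_linear piD. Qed.

Lemma hq_comul1 : hq_comul 1 = tens 1 1.
Proof.
rewrite -[1 in LHS]/(hpi 1) hq_comul_pi comul1 [LHS]tlift_tens //.
exact: bilin_comp (@tens_bilin K L L) piD piD.
Qed.

Lemma hq_comulM (p q : L) : hq_comul (p * q) =
  tlift (fun a1 a2 =>
    tlift (fun b1 b2 => tens (a1 * b1) (a2 * b2)) (hq_comul q)) (hq_comul p).
Proof.
have bt := @tens_bilin K L L; have bm := @mul_bilin K L.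
have [[x ->] [y ->]] := (hpi_surj p, hpi_surj q).
rewrite -piM !hq_comul_pi comulM {1}/tmap tlift_tlift.
rewrite [RHS]tlift_tmap; last first.
  apply: tlift_bilin => u w.
  by apply: bilin_comp bt _ _; exact: bm.1.
apply: eq_tlift => a1 a2; rewrite tlift_tlift [RHS]tlift_tmap; last first.
  by apply: bilin_comp bt _ _; exact: bm.2.
apply: eq_tlift => b1 b2; rewrite tlift_tens ?piM //.
exact: bilin_comp bt piD piD.
Qed.

Lemma hq_counit1 : hq_counit 1 = 1.
Proof. by rewrite -[1 in LHS]/(hpi 1) hq_counit_pi counit1. Qed.

Lemma hq_counitM : {morph hq_counit : a b / a * b}.
Proof.
move=> p q; have [[x ->] [y ->]] := (hpi_surj p, hpi_surj q).
by rewrite -piM !hq_counit_pi counitM.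
Qed.

Lemma hq_comulA (q : L) :
  tlift (fun a1 a2 =>
    tlift (fun a11 a12 => tens a11 (tens a12 a2)) (hq_comul a1)) (hq_comul q) =
  tlift (fun a1 a2 => tens a1 (hq_comul a2)) (hq_comul q).
Proof.
have [x ->] := hpi_surj q; rewrite hq_comul_pi.
have bt := @tens_bilin K L L; have bt3 := @tens_bilin K L (tensor L L).
rewrite tlift_tmap; last first.
  split=> [w|u] c y z; first by rewrite hq_comul_linear linearP.
  rewrite /tlift scaler_sumr -big_split; apply: eq_bigr => i _ /=.
  rewrite scaler_sumr -big_split; apply: eq_bigr => j _ /=.
  by rewrite bt.2 bt3.2 scalerDr !scalerA mulrC.
rewrite tlift_tmap; last first.
  by apply: (bilin_comp (g := id) bt3) => //; exact: hq_comul_linear.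
have lT : linear (tmap (W := tensor H H) hpi (tmap hpi hpi)).
  exact: tmap_linear.
have lm := @tmap_linear K _ _ _ _ hpi hpi.
have bp := bilin_comp (@tens_bilin K L L) piD piD.
have bp3 := bilin_comp (@tens_bilin K L (tensor L L)) piD lm.
have := congr1 (tmap (W := tensor H H) hpi (tmap hpi hpi)) (comulA x).
rewrite (tlift_comp _ _ lT) [RHS](tlift_comp _ _ lT) => e.
etransitivity; last etransitivity; [|exact: e|].
  apply: eq_tlift => a1 a2; rewrite hq_comul_pi (tlift_comp _ _ lT).
  rewrite tlift_tmap; last first.
    split=> [w|u] c y z; first by rewrite bt3.1.
    by rewrite bt.1 bt3.2.
  apply: eq_tlift => b1 b2; rewrite [RHS]tlift_tens //.
  by rewrite [in RHS]/tmap tlift_tens.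
by apply: eq_tlift => a1 a2; rewrite [LHS]tlift_tens // hq_comul_pi.
Qed.

Lemma hq_counitl (q : L) : tlift (fun a1 a2 => hq_counit a1 *: a2) (hq_comul q) = q.
Proof.
have [x ->] := hpi_surj q; rewrite hq_comul_pi tlift_tmap; last first.
  split=> [w|u] c y z; first by rewrite hq_counit_scalar scalerDl scalerA.
  by rewrite scalerDr !scalerA mulrC.
rewrite -[in RHS](counit_comull x) (tlift_comp _ _ piD).
by apply: eq_tlift => a1 a2; rewrite hq_counit_pi linearZ.
Qed.

Lemma hq_counitr (q : L) : tlift (fun a1 a2 => hq_counit a2 *: a1) (hq_comul q) = q.
Proof.
have [x ->] := hpi_surj q; rewrite hq_comul_pi tlift_tmap; last first.
  split=> [w|u] c y z; last by rewrite hq_counit_scalar scalerDl scalerA.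
  by rewrite scalerDr !scalerA mulrC.
rewrite -[in RHS](counit_comulr x) (tlift_comp _ _ piD).
by apply: eq_tlift => a1 a2; rewrite hq_counit_pi linearZ.
Qed.

Lemma hq_antipodel (q : L) :
  tlift (fun a1 a2 => hq_antipode a1 * a2) (hq_comul q) = hq_counit q *: 1.
Proof.
have [x ->] := hpi_surj q; rewrite hq_comul_pi tlift_tmap; last first.
  by apply: (bilin_comp (h := id) (@mul_bilin K L)) => //; exact: hq_antipode_linear.
rewrite hq_counit_pi.
have -> : counit x *: (1 : L) = hpi (counit x *: 1) by rewrite linearZ.
rewrite -antipodel (tlift_comp _ _ piD).
by apply: eq_tlift => a1 a2; rewrite hq_antipode_pi piM.
Qed.

Lemma hq_antipoder (q : L) :
  tlift (fun a1 a2 => a1 * hq_antipode a2) (hq_comul q) = hq_counit q *: 1.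
Proof.
have [x ->] := hpi_surj q; rewrite hq_comul_pi tlift_tmap; last first.
  by apply: (bilin_comp (g := id) (@mul_bilin K L)) => //; exact: hq_antipode_linear.
rewrite hq_counit_pi.
have -> : counit x *: (1 : L) = hpi (counit x *: 1) by rewrite linearZ.
rewrite -antipoder (tlift_comp _ _ piD).
by apply: eq_tlift => a1 a2; rewrite hq_antipode_pi piM.
Qed.

HB.instance Definition _ := Falgebra_isHopf.Build K L
  hq_comul_linear hq_counit_scalar hq_antipode_linear hq_comul1 hq_comulM
  hq_counit1 hq_counitM hq_comulA hq_counitl hq_counitr hq_antipodel hq_antipoder.

Section QuotientModule.
Variable V : hmodule H.
Hypothesis JV : forall (x : H) (v : V), x \in J -> hact x v = 0.

Definition hq_act (q : L) (v : V) : V := hact (hrep q) v.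

Lemma hq_act_pi x v : hq_act (hpi x) v = hact x v.
Proof.
have := JV v (hpiK x); rewrite -scaleN1r addrC (hact_bilin V).1.
by rewrite scaleN1r addrC => /subr0_eq.
Qed.

Lemma hq_act_bilin : bilin hq_act.
Proof.
apply: (bilin_comp (h := id) (hact_bilin V)) => //; exact: hrep_linear.
Qed.

Lemma hq_act1 v : hq_act 1 v = v.
Proof. by rewrite -[1]/(hpi 1) hq_act_pi hact1. Qed.

Lemma hq_actM a b v : hq_act (a * b) v = hq_act a (hq_act b v).
Proof.
have [[x ->] [y ->]] := (hpi_surj a, hpi_surj b).
by rewrite -piM !hq_act_pi hactM.
Qed.

Definition quot_module : hmodule L := HModule hq_act_bilin hq_act1 hq_actM.

End QuotientModule.
End Quotient.

Definition cyclic_group (A : unitRingType) (G : set A) : Prop :=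
  exists2 g, g \is a GRing.unit & G = range (fun z : int => g ^ z).

Section Imprimitivity.
Variable (R : realType) (k : nat) (A : 'M[nat]_k).

Definition cmatrix : 'M[R[i]]_k := map_mx (fun n => n%:R) A.

Definition perron_eigenvalue (lam : R[i]) : Prop :=
  [/\ eigenvalue cmatrix lam, 0 <= lam
    & forall mu, eigenvalue cmatrix mu -> `|mu| <= lam].

(* The index is 0 when there is no Perron-Frobenius eigenvalue, which does    *)
(* not happen when k > 0.                                                     *)
Definition imprimitivity_index : nat :=
  #|` fset_set [set mu : R[i] | eigenvalue cmatrix mu /\
        exists2 lam, perron_eigenvalue lam & `|mu| = lam]|%fset.

End Imprimitivity.

(* Main.v *)
(* Write V^m for the m-th tensor power and L = H/J, so that an element of L killing every
   V^m is zero. For Q simple, Q is a composition factor of M iff ann M annihilates Q; with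
   this description everything reduces to ideals and annihilators. Let h be the gcd of the
   "return times" d, those for which some V^m and V^(m+d) share a composition factor.
   - If g is grouplike and acts on V by xi, it acts on V^m by xi^m; hence g is central,
     determined by xi, and xi^h = 1. Conversely, the ideals J_r = ann (sum of V^m, m = r mod h)
     are pairwise comaximal, so for each h-th root of unity z the Chinese remainder theorem
     gives g acting on every V^m by z^m; such a g is grouplike because L tensor L
     acts faithfully on the sum of all V^m tensor V^n. Thus G_V is cyclic of order h.
   - The dimension vector d is a left eigenvector of A for n = dim V. If u A = mu u with
     |mu| = n, write u_i = d_i w_i; at an index j where |w_j| is maximal the triangle
     inequality is an equality, so w_i = (mu/n) w_j whenever a_ij <> 0. The trivial module is
     reached from j since it is a factor of some V^m tensor S_j, and comparing values along
     return times gives (mu/n)^h = 1. Conversely each h-th root of unity twists d into an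
     eigenvector. *)
From HB Require Import structures.
Require Import Defs.
From mathcomp Require Import all_boot all_order all_algebra all_field.
From mathcomp Require Import finmap boolp classical_sets cardinality reals.
From mathcomp Require Import complex ring.
Set Implicit Arguments.
Unset Strict Implicit.
Unset Printing Implicit Defensive.
Import Order.TTheory GRing.Theory Num.Theory.
Local Open Scope ring_scope.

(** * Tensors *)

Section TensorLemmas.
Variable K : fieldType.
Implicit Types U W X Y : vectType K.

Lemma linear_fun0 U X (f : U -> X) : linear f -> f 0 = 0.
Proof. by move=> lf; have := lf (-1) 0 0; rewrite scaler0 add0r scaleN1r addNr. Qed.

Lemma linear_funZ U X (f : U -> X) c u : linear f -> f (c *: u) = c *: f u.
Proof. by move=> lf; have := lf c u 0; rewrite (linear_fun0 lf) !addr0. Qed.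

Lemma linear_funD U X (f : U -> X) u v : linear f -> f (u + v) = f u + f v.
Proof. by move=> lf; have := lf 1 u v; rewrite !scale1r. Qed.

Lemma linear_funB U X (f : U -> X) u v : linear f -> f (u - v) = f u - f v.
Proof. by move=> lf; rewrite addrC -scaleN1r lf scaleN1r addrC. Qed.

Lemma linfunE U X (f : U -> X) : linear f -> linfun f =1 f.
Proof.
move=> lf u.
pose g := HB.pack_for {linear U -> X} f (GRing.isLinear.Build K U X _ f lf).
by rewrite -[f]/(g : U -> X) lfunE.
Qed.

Lemma bilin_tensl U W X (f : X -> U) (w : W) : linear f -> linear (fun x => tens (f x) w).
Proof. by move=> lf c x y; rewrite lf (tens_bilin U W).1. Qed.

Lemma bilin_tensr U W X (f : X -> W) (u : U) : linear f -> linear (fun x => tens u (f x)).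
Proof. by move=> lf c x y; rewrite lf (tens_bilin U W).2. Qed.

Lemma tlift_eq0 U W X (f : U -> W -> X) t : (forall u w, f u w = 0) -> tlift f t = 0.
Proof.
move=> f0; rewrite /tlift big1 // => i _; rewrite big1 // => j _.
by rewrite f0 scaler0.
Qed.

Lemma tliftD U W X (f g : U -> W -> X) t :
  tlift (fun u w => f u w + g u w) t = tlift f t + tlift g t.
Proof.
rewrite /tlift -big_split; apply: eq_bigr => i _ /=.
by rewrite -big_split; apply: eq_bigr => j _ /=; rewrite scalerDr.
Qed.

Lemma tlift_mem U W X (f : U -> W -> X) (P : {vspace X}) t :
  (forall u w, f u w \in P) -> tlift f t \in P.
Proof.
by move=> fP; apply: memv_suml => i _; apply: memv_suml => j _; rewrite memvZ.
Qed.

Lemma tensor_ext U W X (f g : tensor U W -> X) : linear f -> linear g ->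
  (forall u w, f (tens u w) = g (tens u w)) -> f =1 g.
Proof.
move=> lf lg e t; rewrite -[t]tlift_id (tlift_comp _ _ lf) (tlift_comp _ _ lg).
by apply: eq_tlift.
Qed.

Lemma tensorE U W (t : tensor U W) i j : t i j =
  tlift (fun u w => (coord (vbasis {:U}) i u * coord (vbasis {:W}) j w) : K^o) t.
Proof.
rewrite -[t in LHS]tlift_id (@tlift_comp K U W _ K^o (fun s : tensor U W => s i j)).
  by apply: (@eq_tlift _ _ _ K^o) => u w; rewrite mxE.
by move=> c x y; rewrite !mxE.
Qed.

Lemma coord_linear n U (b : n.-tuple U) i : linear (coord b i : U -> K^o).
Proof. by move=> c x y; rewrite linearP. Qed.

(** Each entry of [t] is a coordinate of the slice of [t] by a coordinate functional on the left
    factor, so questions about tensors reduce to questions about vectors. *)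
Lemma tensor_eq0l U W (t : tensor U W) :
  (forall f : U -> K^o, linear f -> tlift (fun u w => (f u : K) *: w) t = 0) -> t = 0.
Proof.
move=> t0; apply/matrixP => i j; rewrite mxE tensorE.
have /t0 := coord_linear (vbasis {:U}) i.
move/(congr1 (coord (vbasis {:W}) j : W -> K^o)).
rewrite linear0 (tlift_comp _ _ (coord_linear (vbasis {:W}) j)) => <-.
by apply: (@eq_tlift _ _ _ K^o) => u w; rewrite linearZ.
Qed.

Lemma tensor_eq0r U W (t : tensor U W) :
  (forall f : W -> K^o, linear f -> tlift (fun u w => (f w : K) *: u) t = 0) -> t = 0.
Proof.
move=> t0; apply/matrixP => i j; rewrite mxE tensorE.
have /t0 := coord_linear (vbasis {:W}) j.
move/(congr1 (coord (vbasis {:U}) i : U -> K^o)).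
rewrite linear0 (tlift_comp _ _ (coord_linear (vbasis {:U}) i)) => <-.
by apply: (@eq_tlift _ _ _ K^o) => u w; rewrite linearZ mulrC.
Qed.

Lemma tens_eq0 U W (u : U) (w : W) : u != 0 -> tens u w = 0 -> w = 0.
Proof.
move=> u0 t0; apply/eqP; apply: contraNT u0 => w0.
rewrite (coord_vbasis (memvf u)) big1 // => i _.
have [j wj] : exists j, coord (vbasis {:W}) j w != 0.
  apply/existsP; rewrite -negb_forall; apply: contra w0 => /forallP w0.
  by rewrite (coord_vbasis (memvf w)) big1 // => j _; rewrite (eqP (w0 j)) scale0r.
have /matrixP/(_ i j) := t0; rewrite !mxE => /eqP.
by rewrite mulf_eq0 (negPf wj) orbF => /eqP->; rewrite scale0r.
Qed.

(* [u - projv J u] is the component of [u] in the complement of [J]. *)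
Lemma tens_vs_coker U (J : {vspace U}) (t : tensor U U) :
  tlift (fun u w => tens (u - projv J u) (w - projv J w)) t = 0 ->
  t \in (tens_vs J {:U} + tens_vs {:U} J)%VS.
Proof.
move=> t0; rewrite -[t]tlift_id.
pose p (u : U) := u - projv J u.
(* Split both legs along [J] and its complement: the purely complementary part vanishes on [t] by
   hypothesis, and each remaining term has a leg in [J]. *)
have e u w : tens u w = tens (p u) (p w) + (tens (projv J u) w + tens (p u) (projv J w)).
  rewrite addrCA -linear_funD; last exact: (tens_bilin U U).2.
  by rewrite subrK -(linear_funD _ _ ((tens_bilin U U).1 _)) addrC subrK.
rewrite (eq_tlift _ e) tliftD t0 add0r tliftD; apply: memv_add; apply: tlift_mem => u w.
  by apply: tens_in_vs; rewrite ?memvf ?memv_proj.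
by apply: tens_in_vs; rewrite ?memvf ?memv_proj.
Qed.

(** Turns the criterion [kills2_powers] for [J = 0] into an equation in the tensor square, which is
    how grouplikes are recognised. *)
Lemma tens_vs0 U : (tens_vs 0 {:U} + tens_vs {:U} 0 = 0 :> {vspace tensor U U})%VS.
Proof.
have tens0 (u : U) : tens 0 u = 0 :> tensor U U /\ tens u 0 = 0 :> tensor U U.
  by split; [exact: (linear_fun0 ((tens_bilin U U).1 u))
            |exact: (linear_fun0 ((tens_bilin U U).2 u))].
apply/eqP; rewrite -subv0 subv_add; apply/andP; split; apply/span_subvP => x;
  case/allpairsP => [[u w] /= [ux wx ->]]; rewrite memv0.
  by move/vbasis_mem: ux; rewrite memv0 => /eqP->; rewrite (tens0 w).1.
by move/vbasis_mem: wx; rewrite memv0 => /eqP->; rewrite (tens0 u).2.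
Qed.

End TensorLemmas.

(** * Modules over a finite-dimensional algebra *)

Lemma linear_fun_sum (K : fieldType) (U X : vectType K) (f : U -> X) (I : Type)
    (r : seq I) (P : pred I) (F : I -> U) :
  linear f -> f (\sum_(i <- r | P i) F i) = \sum_(i <- r | P i) f (F i).
Proof.
move=> lf; apply: (big_morph f) => [u v|]; first exact: linear_funD.
exact: linear_fun0.
Qed.

Section ModuleLemmas.
Variables (K : fieldType) (A : falgType K).
Implicit Types (M N Q S : hmodule A) (a b x y : A).

Definition kills M x : Prop := forall v : M, hact x v = 0.

(* For a simple module [Q], [ann_sub M Q] says that [Q] is a composition factor of [M]. *)
Definition ann_sub M N : Prop := forall x, kills M x -> kills N x.

Definition intertwiner M N (f : M -> N) : Prop :=
  linear f /\ forall a v, f (hact a v) = hact a (f v).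

Definition two_sided_ideal (I : A -> Prop) : Prop :=
  [/\ I 0, forall c x y, I x -> I y -> I (c *: x + y)
    & forall a x, I x -> I (a * x) /\ I (x * a)].

Lemma hact_linl M (v : M) : linear (fun a => hact a v).
Proof. exact: (hact_bilin M).1. Qed.

Lemma hact_linr M a : linear (@hact _ _ M a).
Proof. exact: (hact_bilin M).2. Qed.

(** Scalar action becomes annihilation, so that it passes along [ann_sub] from a module to its
    factors. *)
Lemma killsP M x c :
  (forall v : M, hact x v = c *: v) <-> kills M (x - c *: 1).
Proof.
have e (v : M) : hact (x - c *: 1) v = hact x v - c *: v.
  rewrite (linear_funB _ _ (hact_linl v)) (linear_funZ _ _ (hact_linl v)).
  by rewrite hact1.
split=> h v; first by rewrite e h subrr.
by apply/eqP; rewrite -subr_eq0 -e h.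
Qed.

Lemma kills_ideal M : two_sided_ideal (kills M).
Proof.
split=> [v|c x y xM yM v|a x xM]; first exact: linear_fun0 (hact_linl v).
  by rewrite (hact_linl v) xM yM scaler0 addr0.
by split=> v; rewrite hactM xM // (linear_fun0 (hact_linr _)).
Qed.

Lemma ideal_forall T (I : T -> A -> Prop) :
  (forall t, two_sided_ideal (I t)) -> two_sided_ideal (fun x => forall t, I t x).
Proof.
move=> hI; split=> [t|c x y xI yI t|a x xI]; first by have [] := hI t.
  by have [_ lin _] := hI t; apply: lin.
by split=> t; have [_ _ mul] := hI t; have [] := mul a x (xI t).
Qed.

Lemma nonzero_vector (U : vectType K) : {:U}%VS <> 0%VS -> exists v : U, v != 0.
Proof.
move=> U0; exists (vpick {:U}); rewrite vpick0; exact/eqP.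
Qed.

Lemma simple_nonzero S : simple_module S -> exists v : S, v != 0.
Proof. by case=> /nonzero_vector. Qed.

(** * Submodules and quotient modules *)

Section Retract.
Variables (M : hmodule A) (X : vectType K) (p : M -> X) (i : X -> M).
Hypotheses (lp : linear p) (li : linear i) (ip : forall q, p (i q) = q).
Hypothesis pM : forall a b q,
  p (hact (a * b) (i q)) = p (hact a (i (p (hact b (i q))))).

Lemma retract_bilin : bilin (fun a q => p (hact a (i q))).
Proof.
by split=> [q|a] c x y; rewrite ?li ?(hact_linl (i q)) ?(hact_linr a) lp.
Qed.

Lemma retract_act1 q : p (hact 1 (i q)) = q. Proof. by rewrite hact1 ip. Qed.

(** Serves twice: [p] is a projection onto a submodule, or a quotient map with [i] the inclusion of
    a complement. *)
Definition retract_module : hmodule A := HModule retract_bilin retract_act1 pM.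
End Retract.

Section SubQuotient.
Variables (M : hmodule A) (U : {vspace M}).
Hypothesis hU : submodule U.

Let vsval_linear : linear (vsval : subvs_of U -> M). Proof. by move=> c x y. Qed.
Let vsproj_linear : linear (vsproj U). Proof. by move=> c x y; rewrite linearP. Qed.

Let sub_actM a b (u : subvs_of U) : vsproj U (hact (a * b) (vsval u)) =
  vsproj U (hact a (vsval (vsproj U (hact b (vsval u))))).
Proof. by rewrite vsprojK ?hactM //; apply/hU/subvsP. Qed.

Definition sub_module : hmodule A :=
  retract_module vsproj_linear vsval_linear (@vsvalK _ _ U) sub_actM.

Lemma sub_intertwiner : @intertwiner sub_module M vsval.
Proof. by split=> // a u; rewrite vsprojK //; apply/hU/subvsP. Qed.

Definition quo_pi (v : M) : subvs_of (U^C)%VS := vsproj (U^C)%VS (v - projv U v).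

Lemma quo_pi_linear : linear quo_pi.
Proof.
move=> c x y; rewrite /quo_pi -linearP; congr (vsproj _ _).
by rewrite linearP /= opprD addrACA scalerBr.
Qed.

Lemma quo_pi_val v : vsval (quo_pi v) = v - projv U v.
Proof. by rewrite vsprojK // memv_projC. Qed.

Lemma quo_pi_eq0 v : (quo_pi v == 0) = (v \in U).
Proof.
apply/eqP/idP => [e|vU]; last by rewrite /quo_pi projv_id // subrr linear0.
have := quo_pi_val v; rewrite e linear0 => /esym/eqP.
by rewrite subr_eq0 => /eqP->; exact: memv_proj.
Qed.

Lemma quo_valK (q : subvs_of (U^C)%VS) : quo_pi (vsval q) = q.
Proof.
apply: val_inj; rewrite /= quo_pi_val.
have: projv U (vsval q) \in (U :&: U^C)%VS.
  rewrite memv_cap memv_proj -[X in X \in _](subKr (vsval q)) rpredB ?subvsP //.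
  exact: memv_projC.
by rewrite capv_compl memv0 => /eqP->; rewrite subr0.
Qed.

Let val_linear : linear (vsval : subvs_of (U^C)%VS -> M). Proof. by move=> c x y. Qed.

Lemma quo_pi_act a (v : M) : quo_pi (hact a (vsval (quo_pi v) : M)) = quo_pi (hact a v).
Proof.
apply/eqP; rewrite -subr_eq0 -(linear_funB _ _ quo_pi_linear).
rewrite -(linear_funB _ _ (hact_linr a)) quo_pi_eq0; apply: hU.
by rewrite quo_pi_val addrAC subrr sub0r rpredN memv_proj.
Qed.

Let quo_actM a b (q : subvs_of (U^C)%VS) : quo_pi (hact (a * b) (vsval q : M)) =
  quo_pi (hact a (vsval (quo_pi (hact b (vsval q : M))) : M)).
Proof. by rewrite quo_pi_act hactM. Qed.

Definition quo_module : hmodule A :=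
  retract_module quo_pi_linear val_linear quo_valK quo_actM.

Lemma quo_intertwiner : @intertwiner M quo_module quo_pi.
Proof. by split=> [|a v]; [exact: quo_pi_linear|rewrite /= quo_pi_act]. Qed.

End SubQuotient.

Lemma ann_sub_surj M N (f : M -> N) : intertwiner f ->
  (forall w, exists v, f v = w) -> ann_sub M N.
Proof. by move=> [lf fa] sf x xM w; have [v <-] := sf w; rewrite -fa xM (linear_fun0 lf). Qed.

Lemma ann_sub_inj M N (f : M -> N) : intertwiner f ->
  (forall v, f v = 0 -> v = 0) -> ann_sub N M.
Proof. by move=> [lf fa] f0 x xN v; apply: f0; rewrite fa xN. Qed.

Lemma ann_sub_sub M (U : {vspace M}) (hU : submodule U) : ann_sub M (sub_module hU).
Proof.
apply: ann_sub_inj (sub_intertwiner hU) _ => v v0.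
by apply: val_inj; exact: v0.
Qed.

Lemma ann_sub_quo M (U : {vspace M}) (hU : submodule U) : ann_sub M (quo_module hU).
Proof.
apply: ann_sub_surj (quo_intertwiner hU) _ => w.
by exists (vsval w); rewrite quo_valK.
Qed.

Lemma ann_sub_trans N M Q : ann_sub M N -> ann_sub N Q -> ann_sub M Q.
Proof. by move=> MN NQ x /MN/NQ. Qed.

Lemma not_kills M x : ~ kills M x -> exists v : M, hact x v != 0.
Proof.
move=> xM; apply: contrapT => h; apply: xM => v; apply/eqP.
by apply: contrapT => /negP hv; apply: h; exists v.
Qed.

(** * Simple modules and their annihilators *)

Lemma simple_cyclic S (v w : S) : simple_module S -> v != 0 -> exists a, hact a v = w.
Proof.
move=> [_ sS] v0; pose f := linfun (fun a : A => hact a v).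
have fE : f =1 (fun a : A => hact a v) := linfunE (hact_linl v).
have [a u /memv_imgP[b _ ->]|e|e] := sS (limg f).
- by rewrite fE -hactM -[hact _ _]fE memv_img ?memvf.
- have := memv_img f (memvf 1); rewrite e fE hact1 memv0 (negPf v0) //.
- have := memvf w; rewrite -e => /memv_imgP[a _ ->]; exists a; rewrite fE //.
Qed.

(** The annihilator of a simple module is a prime ideal: if [y v] is nonzero, then [A y v] is all of
    [S], and [x] kills it. *)
Lemma simple_prime S x y : simple_module S ->
  (forall a, kills S (x * a * y)) -> kills S x \/ kills S y.
Proof.
move=> sS h; have [yS|/not_kills[v yv]] := pselect (kills S y); first by right.
left=> w; have [a <-] := simple_cyclic w sS yv.
by rewrite -!hactM h.
Qed.

(** If [Q] is not a factor of the quotient, some [y] kills the quotient but not [Q]. For [x] killing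
    the submodule, every [x a y] kills [M], hence [Q], and primeness shows that [x] kills [Q]. *)
Lemma ann_sub_ext M (U : {vspace M}) (hU : submodule U) Q : simple_module Q ->
  ann_sub M Q <-> ann_sub (sub_module hU) Q \/ ann_sub (quo_module hU) Q.
Proof.
move=> sQ; split=> [MQ|[]]; last 2 first.
- by apply: ann_sub_trans; exact: ann_sub_sub.
- by apply: ann_sub_trans; exact: ann_sub_quo.
have [|nQ] := pselect (ann_sub (quo_module hU) Q); [by right|left=> x xU].
have [y [yM yQ]] : exists y, kills (quo_module hU) y /\ ~ kills Q y.
  by apply: contrapT => h; apply: nQ => y yM; apply: contrapT => yQ; apply: h; exists y.
have [a|//|/yQ//] := @simple_prime Q x y sQ.
apply: MQ => v; rewrite !hactM.
have: hact y v \in U.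
  rewrite -(quo_pi_eq0 U) (quo_intertwiner hU).2.
  by rewrite (yM (quo_pi U v)).
move=> yvU; have ayvU := hU a _ yvU.
have := xU (vsproj U (hact a (hact y v))) => /(congr1 vsval).
by rewrite (sub_intertwiner hU).2 vsprojK // linear0.
Qed.

(** Take [U] proper of largest dimension: the preimage of a submodule of the quotient contains [U],
    so it is [U] or everything. *)
Lemma simple_quotient M : {:M}%VS <> 0%VS ->
  exists2 U : {vspace M}, submodule U & forall hU : submodule U, simple_module (quo_module hU).
Proof.
move=> M0.
pose P n := `[< exists2 U : {vspace M}, \dim U = n & submodule U /\ U <> fullv >].
have exP : exists n, P n.
  exists 0%N; apply/asboolP; exists 0%VS; first by rewrite dimv0.
  split; last exact/nesym.
  by move=> a u; rewrite !memv0 => /eqP->; rewrite (linear_fun0 (hact_linr _)).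
have ubP n : P n -> (n <= \dim {:M})%N.
  by move=> /asboolP[U <- _]; apply/dimvS/subvf.
case: (ex_maxnP exP ubP) => n /asboolP[U dU [hU nU]] nmax; exists U => // hU'.
split.
  move=> q0; apply: nU; apply/eqP; rewrite eqEsubv subvf; apply/subvP => v _.
  have : quo_pi U v \in {:quo_module hU'}%VS by exact: memvf.
  by rewrite q0 memv0 quo_pi_eq0.
move=> W hW; pose f := linfun (quo_pi U).
have fE : f =1 quo_pi U := linfunE (@quo_pi_linear _ U).
have [e|nP] := pselect ((f @^-1: W)%VS = fullv).
  right; apply/eqP; rewrite eqEsubv subvf; apply/subvP => q _.
  by rewrite -[q]quo_valK -fE memv_preim e memvf.
left.
have hP : submodule (f @^-1: W)%VS.
  move=> a u; rewrite -!memv_preim !fE => /(hW a).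
  by rewrite -(quo_intertwiner hU').2.
have UP : (U <= f @^-1: W)%VS.
  by apply/subvP => u; rewrite -(quo_pi_eq0 U) -memv_preim fE => /eqP->; exact: mem0v.
have eU : (U == f @^-1: W)%VS.
  rewrite eqEdim UP dU; apply: nmax; apply/asboolP; eexists; first by [].
  by [].
apply/eqP; rewrite -subv0; apply/subvP => q qW; rewrite memv0.
have: vsval q \in (f @^-1: W)%VS by rewrite -memv_preim fE quo_valK.
by rewrite -(eqP eU) -(quo_pi_eq0 U) quo_valK.
Qed.

Lemma simple_factor M : {:M}%VS <> 0%VS -> exists2 Q, simple_module Q & ann_sub M Q.
Proof.
move=> /simple_quotient[U hU sU]; exists (quo_module hU) => //.
exact: ann_sub_quo.
Qed.

(** Kernel and image are submodules, so a nonzero intertwiner between simple modules is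
    bijective. *)
Lemma schur S Q (f : S -> Q) : simple_module S -> simple_module Q -> intertwiner f ->
  (exists v, f v <> 0) -> exists2 g : Q -> S, linear g & cancel f g /\ cancel g f.
Proof.
move=> [_ sS] [_ sQ] [lf fa] [v fv].
pose F := linfun f; have FE : F =1 f := linfunE lf.
have k0 : lker F == 0%VS.
  have [a u|/eqP//|e] := sS (lker F).
    by rewrite !memv_ker !FE fa => /eqP->; rewrite (linear_fun0 (hact_linr _)).
  by case: fv; apply/eqP; rewrite -FE -memv_ker e memvf.
have i1 : limg F = fullv.
  have [a u /memv_imgP[w _ ->]|e|//] := sQ (limg F).
    by rewrite FE -fa -FE memv_img ?memvf.
  by case: fv; apply/eqP; rewrite -FE -memv0 -e memv_img ?memvf.
exists (F^-1)%VF; first by move=> c x y; rewrite linearP.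
split=> [w|w]; first by rewrite -FE lker0_lfunK.
by rewrite -FE limg_lfunVK // i1 memvf.
Qed.

(* If [ann S] annihilates [Q], take a minimal left ideal [N] with [N q <> 0] for a fixed
   [q <> 0]. Some [s] has [N s <> 0]; by minimality the [b] in [N] killing [s] also kill
   [q], so [b s |-> b q] is a well-defined nonzero homomorphism [S -> Q]. *)
Lemma simple_ann_iso S Q : simple_module S -> simple_module Q -> ann_sub S Q ->
  exists f : S -> Q, intertwiner f /\
    exists2 g : Q -> S, linear g & cancel f g /\ cancel g f.
Proof.
move=> sS sQ SQ; have [q q0] := simple_nonzero sQ.
pose lideal (N : {vspace A}) := forall a b, b \in N -> a * b \in N.
pose P n := `[< exists2 N : {vspace A}, \dim N = n &
  lideal N /\ exists2 b, b \in N & hact b q != 0 >].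
have exP : exists n, P n.
  exists (\dim {:A}); apply/asboolP; exists fullv => //; split=> [a b _|].
    exact: memvf.
  by exists 1; rewrite ?memvf ?hact1.
case: (ex_minnP exP) => n /asboolP[N dN [hN [b0 b0N b0q]]] nmin.
have [s [b1 b1N b1s]] : exists s : S, exists2 b, b \in N & hact b s != 0.
  apply: contrapT => h; case/eqP: b0q; apply: SQ => s; apply/eqP.
  by apply: contrapT => /negP b0s; apply: h; exists s, b0.
have kN b : b \in N -> hact b s = 0 -> hact b q = 0.
  move=> bN bs; apply/eqP; apply: contrapT => /negP bq.
  pose F := linfun (fun a : A => hact a s).
  have FE : F =1 (fun a : A => hact a s) := linfunE (hact_linl s).
  have := nmin (\dim (N :&: lker F)%VS); rewrite -dN => h.
  have /h : P (\dim (N :&: lker F)%VS).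
    apply/asboolP; exists (N :&: lker F)%VS => //; split.
      move=> a x; rewrite !memv_cap !memv_ker !FE => /andP[xN /eqP xs].
      by rewrite hN // hactM xs (linear_fun0 (hact_linr _)) eqxx.
    by exists b; rewrite // memv_cap bN memv_ker FE bs eqxx.
  move=> dle; have /eqP eN : (N :&: lker F == N)%VS by rewrite eqEdim capvSl.
  by case/eqP: b1s; move: b1N; rewrite -eN memv_cap memv_ker FE => /andP[_ /eqP].
have /choice[be be_spec] : forall v, exists b, b \in N /\ hact b s = v.
  move=> v; have [a <-] := simple_cyclic v sS b1s.
  by exists (a * b1); rewrite hN // hactM.
pose f v := hact (be v) q.
have fE b : b \in N -> f (hact b s) = hact b q.
  move=> bN; apply/eqP; rewrite -subr_eq0 -(linear_funB _ _ (hact_linl q)).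
  have [beN bes] := be_spec (hact b s).
  by rewrite kN ?rpredB // (linear_funB _ _ (hact_linl s)) bes subrr.
have fI : intertwiner f.
  split=> [c x y|a x].
    have [[xN xs] [yN ys]] := (be_spec x, be_spec y).
    rewrite -[x in LHS]xs -[y in LHS]ys -(hact_linl s) fE.
      by rewrite (hact_linl q).
    by rewrite rpredD ?rpredZ.
  have [xN xs] := be_spec x.
  by rewrite -[x in LHS]xs -hactM fE ?hN // hactM.
exists f; split=> //; apply: schur => //.
by exists (hact b0 s); rewrite fE //; exact/eqP.
Qed.

Lemma ann_sub_simple_sym S Q : simple_module S -> simple_module Q ->
  ann_sub S Q -> ann_sub Q S.
Proof.
move=> sS sQ /(simple_ann_iso sS sQ)[f [fI [g lg [fK _]]]].
by apply: ann_sub_inj fI _ => v fv; rewrite -[v]fK fv (linear_fun0 lg).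
Qed.

(** [U] is the sum of the two ideals. If it misses 1, a simple quotient of the algebra modulo [U] is
    annihilated by both. *)
Lemma comaximal_or_common_factor (I I' : A -> Prop) :
  two_sided_ideal I -> two_sided_ideal I' ->
  (exists2 x, I x & I' (1 - x)) \/
  exists2 Q, simple_module Q &
    (forall x, I x -> kills Q x) /\ (forall x, I' x -> kills Q x).
Proof.
move=> [I0 Ilin Imul] [I'0 I'lin I'mul].
have [||U UP] := @vspace_of_pred K A (fun z => exists2 x, I x & I' (z - x)).
- by exists 0; rewrite // subr0.
- move=> c x y [x1 x1I x1I'] [y1 y1I y1I']; exists (c *: x1 + y1); first exact: Ilin.
  by rewrite opprD addrACA -scalerBr; exact: I'lin.
have [|U1] := boolP (1 \in U); [by move/UP; left|right].
have hU : submodule (M := regular_module A) U.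
  move=> a z /UP[x xI x'I]; apply/UP; exists (a * x); first by case: (Imul a x xI).
  by rewrite -mulrBr; case: (I'mul a _ x'I).
have [|Q sQ qQ] := @simple_factor (quo_module hU).
  move=> e; have : @quo_pi (regular_module A) U 1 \in {:quo_module hU}%VS.
    exact: memvf.
  by rewrite e memv0 quo_pi_eq0 (negPf U1).
exists Q => //.
have kQ x : (forall a, x * a \in U) -> kills Q x.
  move=> xU; apply: qQ => q; rewrite -[q]quo_valK -(quo_intertwiner hU).2.
  by apply/eqP; rewrite quo_pi_eq0 xU.
split=> x xI; apply: kQ => a; apply/UP.
  by exists (x * a); rewrite ?subrr //; case: (Imul a x xI).
by exists 0; rewrite ?subr0 //; case: (I'mul a x xI).
Qed.

(** Chinese remainder step: each [t] provides an element of [J t] congruent to 1 modulo [I], and [e]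
    is the product of these. *)
Lemma ideal_crt (T : eqType) (I : A -> Prop) (J : T -> A -> Prop) (s : seq T) :
  two_sided_ideal I -> (forall t, two_sided_ideal (J t)) ->
  (forall t, t \in s -> exists2 x, I x & J t (1 - x)) ->
  exists2 e, I (1 - e) & forall t, t \in s -> J t e.
Proof.
move=> [I0 Ilin Imul] hJ; elim: s => [|t s IH] hs; first by exists 1; rewrite ?subrr.
have [u us|e eI eJ] := IH; first by apply: hs; rewrite inE us orbT.
have [x xI xJ] := hs t (mem_head _ _).
exists ((1 - x) * e).
  have -> : 1 - (1 - x) * e = 1 *: (1 - e) + x * e.
    by rewrite scale1r mulrBl mul1r opprB addrA addrAC.
  by apply: Ilin => //; case: (Imul e x xI).
move=> u; rewrite inE => /orP[/eqP->|/eJ uJ].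
  by have [_ _ mul] := hJ t; case: (mul e _ xJ).
by have [_ _ mul] := hJ u; case: (mul (1 - x) _ uJ).
Qed.

End ModuleLemmas.

(** * Characters *)

Section CharacterLemmas.
Variables (K : fieldType) (A : falgType K).
Implicit Types (M N Q S : hmodule A) (a b x y : A).

(** The trace may be computed from any family with functionals resolving the identity. This allows
    bases adapted to an extension, an isomorphism or a tensor product. *)
Lemma trace_dual (I : finType) (U : vectType K) (g : U -> U) (u : I -> U)
    (phi : I -> U -> K^o) :
  linear g -> (forall i, linear (phi i)) -> (forall v, v = \sum_i (phi i v : K) *: u i) ->
  \sum_i phi i (g (u i)) =
  \sum_k coord (vbasis {:U}) k (g (vbasis {:U})`_k) :> K^o.
Proof.
move=> lg lphi dual; pose b := vbasis {:U}.
have eg i : phi i (g (u i)) = \sum_(k < \dim {:U}) (phi i (g b`_k) : K) * coord b k (u i) :> K^o.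
  rewrite [u i in LHS](coord_vbasis (memvf _)) (linear_fun_sum _ _ _ lg).
  rewrite (linear_fun_sum _ _ _ (lphi i)); apply: eq_bigr => k _.
  by rewrite (linear_funZ _ _ lg) (linear_funZ _ _ (lphi i)) mulrC.
rewrite (eq_bigr _ (fun i _ => eg i)) exchange_big; apply: eq_bigr => k _ /=.
rewrite [in RHS](dual (g b`_k)) linear_sum; apply: eq_bigr => i _ /=.
by rewrite linearZ.
Qed.

Lemma character_dual M (I : finType) (u : I -> M) (phi : I -> M -> K^o) a :
  (forall i, linear (phi i)) -> (forall v, v = \sum_i (phi i v : K) *: u i) ->
  character M a = \sum_i phi i (hact a (u i)).
Proof.
move=> lphi dual; rewrite characterE.
by rewrite -(trace_dual (hact_linr (M := M) a) lphi dual).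
Qed.

Lemma character_scalar M a c : (forall v : M, hact a v = c *: v) ->
  character M a = c * (\dim {:M})%:R.
Proof.
move=> ac; rewrite characterE.
rewrite (eq_bigr (fun=> c)); last first.
  move=> i _; rewrite ac linearZ /= coord_free ?(basis_free (vbasisP _)) //.
  by rewrite eqxx mulr1.
by rewrite sumr_const card_ord mulr_natr.
Qed.

Lemma character1 M : character M 1 = (\dim {:M})%:R.
Proof.
by rewrite (@character_scalar _ _ 1) ?mul1r // => v; rewrite hact1 scale1r.
Qed.

Lemma character_kills M a : kills M a -> character M a = 0.
Proof. by move=> aM; rewrite (@character_scalar _ _ 0) ?mul0r // => v; rewrite aM scale0r. Qed.

Lemma character_iso M N (f : M -> N) (g : N -> M) : intertwiner f -> linear g ->
  cancel f g -> cancel g f -> character M = character N.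
Proof.
move=> [lf fa] lg fK gK; apply/lfunP => a; rewrite [in LHS]characterE.
pose b := vbasis {:M}.
rewrite (@character_dual N 'I_(\dim {:M}) (fun k => f b`_k) (fun k v => coord b k (g v))).
- by apply: eq_bigr => k _; rewrite -fa fK.
- by move=> k c x y; rewrite lg linearP.
- move=> v; rewrite -[LHS]gK [g v in LHS](coord_vbasis (memvf _)).
  rewrite (linear_fun_sum _ _ _ lf); apply: eq_bigr => k _.
  by rewrite (linear_funZ _ _ lf).
Qed.

(** The resolution of the identity joins a basis of the submodule to lifts of a basis of the
    quotient; on each block the functionals recover the diagonal entries. *)
Lemma character_ext M (U : {vspace M}) (hU : submodule U) :
  character M = character (sub_module hU) + character (quo_module hU).
Proof.
apply/lfunP => a; rewrite lfunE /= [in RHS]characterE [in RHS]characterE.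
pose b := vbasis {:sub_module hU}; pose c := vbasis {:quo_module hU}.
pose u (i : 'I_(\dim {:sub_module hU}) + 'I_(\dim {:quo_module hU})) : M :=
  match i with inl k => vsval (b`_k) | inr k => vsval (c`_k) end.
pose phi (i : 'I_(\dim {:sub_module hU}) + 'I_(\dim {:quo_module hU})) (v : M) : K^o :=
  match i with inl k => coord b k (vsproj U (projv U v)) | inr k => coord c k (quo_pi U v) end.
rewrite (@character_dual M _ u phi).
- rewrite big_sumType /=; congr (_ + _); apply: eq_bigr => k _ //.
  by rewrite projv_id //; exact: (hU a _ (subvsP _)).
- case=> k d x y; rewrite /phi; first by rewrite !linearP.
  by rewrite quo_pi_linear linearP.
- move=> v; rewrite big_sumType /=.
  have e1 := congr1 vsval (coord_vbasis (memvf (vsproj U (projv U v) : sub_module hU))).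
  have e2 := congr1 vsval (coord_vbasis (memvf (quo_pi U v : quo_module hU))).
  rewrite linear_sum /= in e1; rewrite linear_sum /= in e2.
  rewrite vsprojK ?memv_proj // in e1; rewrite quo_pi_val in e2.
  by rewrite -e1 -e2 addrC subrK.
Qed.

(** * Irreducible characters in characteristic zero *)

Section CharZero.
Hypothesis charK : [pchar K] =i pred0.

Lemma natr_eq0 n : (n%:R == 0 :> K) = (n == 0)%N.
Proof. by have /pcharf0P := charK => ->. Qed.

Lemma natr_inj m n : m%:R = n%:R :> K -> m = n.
Proof.
wlog lemn : m n / (m <= n)%N => [h|].
  by case/orP: (leq_total m n) => ? e; [apply: h|apply/esym/h].
move=> /eqP; rewrite eq_sym -subr_eq0 -natrB // natr_eq0 subn_eq0 => lenm.
by apply/eqP; rewrite eqn_leq lemn.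
Qed.

Lemma dim_simple_neq0 S : simple_module S -> (\dim {:S})%:R != 0 :> K.
Proof. by case=> S0 _; rewrite natr_eq0 dimv_eq0; apply/eqP. Qed.

Lemma simple_separated S Q : simple_module S -> simple_module Q ->
  ann_sub S Q \/ exists2 x, kills S x & kills Q (1 - x).
Proof.
move=> sS sQ.
have [|[R sR [SR QR]]] := comaximal_or_common_factor (kills_ideal S) (kills_ideal Q);
  first by right.
left; apply: ann_sub_trans SR _; exact: ann_sub_simple_sym sQ sR QR.
Qed.

(** Otherwise some [x] kills [S] and acts as 1 on [Q]: its traces are 0 and the dimension of [Q],
    which is nonzero in [K]. Conversely, inclusion of annihilators already gives an isomorphism. *)
Lemma eq_characterP S Q : simple_module S -> simple_module Q ->
  character S = character Q <-> ann_sub S Q.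
Proof.
move=> sS sQ; split=> [e|].
  have [//|[x xS xQ]] := simple_separated sS sQ.
  have := character_kills xS; rewrite e => /eqP.
  rewrite (@character_scalar _ _ 1) ?mul1r; first by rewrite (negPf (dim_simple_neq0 sQ)).
  apply/killsP; rewrite scale1r -opprB; move=> v.
  by rewrite -scaleN1r (linear_funZ _ _ (hact_linl v)) xQ scaler0.
move=> /(simple_ann_iso sS sQ)[f [fI [g lg [fK gK]]]].
exact: character_iso fI lg fK gK.
Qed.

(** Some [e] acts as 1 on one of the modules and as 0 on all the others; evaluated at [e], a linear
    relation reduces to a coefficient times a nonzero dimension. *)
Lemma irreducible_characters_free (s : seq 'Hom(A, K^o)) : uniq s ->
  (forall f, f \in s -> exists2 M : hmodule A, simple_module M & f = character M) ->
  free s.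
Proof.
move=> us hs; have /choice[T hT] : forall f, exists M : hmodule A,
    f \in s -> simple_module M /\ f = character M.
  move=> f; have [/hs[M sM ->]|_] := boolP (f \in s); first by exists M.
  by exists (regular_module A).
apply/(freeP (X := in_tuple s)) => c c0 i.
pose f := s`_i; have fs : f \in s by rewrite mem_nth.
have [sf ef] := hT f fs.
have [||t|e eI eJ] := @ideal_crt K A _ (kills (T f)) (fun g => kills (T g)) (rem f s).
- exact: kills_ideal.
- by move=> t; exact: kills_ideal.
- rewrite (mem_rem_uniq _ us) => /andP[/= tf ts]; have [st et] := hT t ts.
  have [h|[x xf xt]] := simple_separated sf st; last by exists x.
  by case/eqP: tf; rewrite [RHS]ef [LHS]et; apply/esym/eq_characterP.
have := congr1 (fun g : 'Hom(A, K^o) => g e) c0.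
rewrite sum_lfunE lfunE /= (bigD1 i) //= big1 => [|j ji].
  rewrite addr0 lfunE /= -/f {1}ef (@character_scalar _ _ 1).
    rewrite mul1r => /eqP; rewrite mulf_eq0 (negPf (dim_simple_neq0 sf)) orbF => /eqP//.
  apply/killsP; rewrite scale1r => v; rewrite -opprB -scaleN1r.
  by rewrite (linear_funZ _ _ (hact_linl v)) eI scaler0.
have js : s`_j \in s by rewrite mem_nth.
have [_ ej] := hT _ js.
rewrite lfunE /= ej character_kills ?scaler0 //; apply: eJ.
by rewrite (mem_rem_uniq _ us) !inE mem_nth // andbT nth_uniq.
Qed.

Lemma finite_irreducible_characters : finite_set
  [set f : 'Hom(A, K^o) | exists2 M : hmodule A, simple_module M & f = character M].
Proof.
apply: contrapT => /(infinite_set_fset (\dim {:'Hom(A, K^o)}).+1)[B sB].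
apply/negP; rewrite -ltnNge ltnS.
have /eqP <- : free (enum_fset B).
  by apply: irreducible_characters_free (fset_uniq B) _ => f /sB.
exact: dimvS (subvf _).
Qed.

(** Induction on the dimension, removing a simple quotient each time. The coefficients count
    composition factors, which ties characters to annihilators. *)
Lemma composition_multiplicities k (T : 'I_k -> hmodule A) M :
  (forall i, simple_module (T i)) -> injective (fun i => character (T i)) ->
  (forall Q, simple_module Q -> exists i, character Q = character (T i)) ->
  exists n : 'I_k -> nat,
    character M = \sum_i (n i)%:R *: character (T i) /\
    forall i, (n i != 0)%N <-> ann_sub M (T i).
Proof.
move=> sT injT compT; have [d] := ubnP (\dim {:M}); elim: d M => // d IH M dM.
have [M0|M0] := pselect ({:M}%VS = 0%VS).
  exists (fun=> 0)%N; split=> [|i].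
    rewrite big1 => [|i _]; last by rewrite scale0r.
    apply/lfunP => a; rewrite zero_lfunE character_kills // => v.
    by apply/eqP; rewrite -memv0 -M0 memvf.
  split=> // MT; have [v v0] := simple_nonzero (sT i); case/eqP: v0.
  rewrite -[v]hact1 MT // => w; rewrite hact1.
  by apply/eqP; rewrite -memv0 -M0 memvf.
have [U hU /(_ hU) sQ] := simple_quotient M0.
have [i0 ei0] := compT _ sQ.
have [|n [en hn]] := IH (sub_module hU).
  have qd : (\dim {:quo_module hU} > 0)%N by rewrite lt0n dimv_eq0; apply/eqP; case: sQ.
  (* Additivity of the dimension is read off from the characters at 1. *)
  have := congr1 (fun g : 'Hom(A, K^o) => g 1) (character_ext hU).
  rewrite lfunE /= !character1 -natrD => /natr_inj e.
  by move: dM; rewrite e ltnS => /(leq_trans _); apply; rewrite -[X in (X < _)%N]addn0 ltn_add2l.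
exists (fun i => (n i + (i == i0))%N); split=> [|i].
  rewrite (character_ext hU) en ei0.
  rewrite [in RHS](eq_bigr (fun i => (n i)%:R *: character (T i) +
      (i == i0)%:R *: character (T i))); last first.
    by move=> i _; rewrite natrD scalerDl.
  rewrite big_split /=; congr (_ + _); rewrite (bigD1 i0) //= eqxx scale1r.
  by rewrite big1 ?addr0 // => j /negPf->; rewrite scale0r.
rewrite (ann_sub_ext hU (sT i)) -hn addn_eq0 negb_and; split.
  case/orP => [|]; first by left.
  rewrite eqb0 negbK => /eqP->; right; apply/eq_characterP => //.
case=> [->//|h]; apply/orP; right; rewrite eqb0 negbK; apply/eqP/injT.
by rewrite -ei0; apply/esym/eq_characterP.
Qed.

End CharZero.
End CharacterLemmas.

(** * Tensor powers and the Hopf ideal *)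

Section HopfLemmas.
Variables (K : fieldType) (H : hopfAlgType K).
Implicit Types (M N V Q : hmodule H) (x : H) (t : tensor H H).

Lemma tlift_linear_param (U W X Y : vectType K) (F : Y -> U -> W -> X) s :
  (forall u w, linear (fun y => F y u w)) -> linear (fun y => tlift (F y) s).
Proof.
move=> lF c y z; rewrite /tlift scaler_sumr -big_split; apply: eq_bigr => i _ /=.
rewrite scaler_sumr -big_split; apply: eq_bigr => j _ /=.
by rewrite lF scalerDr !scalerA mulrC.
Qed.

Lemma bilin_scalel (U W : vectType K) (f : U -> K^o) :
  linear f -> bilin (fun u (w : W) => (f u : K) *: w).
Proof.
move=> lf; split=> [w|u] c y z; first by rewrite lf scalerDl scalerA.
by rewrite scalerDr !scalerA mulrC.
Qed.

Lemma bilin_scaler (U W : vectType K) (f : W -> K^o) :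
  linear f -> bilin (fun (u : U) w => (f w : K) *: u).
Proof.
move=> lf; split=> [w|u] c y z; last by rewrite lf scalerDl scalerA.
by rewrite scalerDr !scalerA mulrC.
Qed.

(** Coassociativity for an arbitrary trilinear [F]: apply to [comulA] the linear map that [F]
    induces on the triple tensor product. *)
Lemma comul_coassoc (X : vectType K) (F : H -> H -> H -> X) x :
  (forall a, bilin (F a)) -> (forall b c, linear (fun a => F a b c)) ->
  tlift (fun a1 a2 => tlift (fun b c => F b c a2) (comul a1)) (comul x) =
  tlift (fun a1 a2 => tlift (F a1) (comul a2)) (comul x).
Proof.
move=> bF lF; pose G (s : tensor H (tensor H H)) := tlift (fun a s => tlift (F a) s) s.
have lG : linear G by exact: tlift_linear.
have bG : bilin (fun a s => tlift (F a) s).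
  by split=> [s|a]; [exact: tlift_linear_param|exact: tlift_linear].
have := congr1 G (comulA x); rewrite (tlift_comp _ _ lG) [in RHS](tlift_comp _ _ lG).
move=> e; etransitivity; last etransitivity; [|exact: e|].
  apply: eq_tlift => a1 a2; rewrite (tlift_comp _ _ lG); apply: eq_tlift => b c.
  by rewrite [RHS]tlift_tens // tlift_tens.
by apply: eq_tlift => a1 a2; rewrite [LHS]tlift_tens.
Qed.

(** Annihilation by the tensor square, tested on pure tensors; [t] may be any tensor, not only a
    coproduct. *)
Definition kills2 M N t : Prop := forall (v : M) (w : N),
  tlift (fun a1 a2 => tens (hact a1 v) (hact a2 w)) t = 0.

Lemma tens_actE M N x (v : M) (w : N) :
  tens_act x (tens v w) = tlift (fun a1 a2 => tens (hact a1 v) (hact a2 w)) (comul x).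
Proof.
apply: eq_tlift => a1 a2; apply: tlift_tens.
by apply: bilin_comp (tens_bilin M N) _ _; exact: hact_linr.
Qed.

Lemma kills_tensorP M N x : kills (tensor_module M N) x <-> kills2 M N (comul x).
Proof.
split=> [h v w|h v]; first by rewrite -tens_actE; exact: h.
apply: (@tensor_ext _ M N _ (tens_act x) (fun=> 0)); first exact: (tens_act_bilin M N).2.
  by move=> c y z; rewrite scaler0 addr0.
by move=> u w; rewrite tens_actE h.
Qed.

(** Slicing the first leg by matrix coefficients of [M] leaves elements of [H], so the condition
    depends on [N] only through its annihilator. *)
Lemma kills2_slicel M N t : kills2 M N t <->
  forall (f : M -> K^o) (v : M), linear f ->
    kills N (tlift (fun a1 a2 => (f (hact a1 v) : K) *: a2) t).
Proof.
have e (f : M -> K^o) v w : linear f ->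
    hact (tlift (fun a1 a2 => (f (hact a1 v) : K) *: a2) t) w =
    tlift (fun u (w : N) => (f u : K) *: w)
      (tlift (fun a1 a2 => tens (hact a1 v) (hact a2 w)) t).
  move=> lf; rewrite (tlift_comp _ _ (hact_linl w)) tlift_tlift.
  apply: eq_tlift => a1 a2; rewrite tlift_tens ?(linear_funZ _ _ (hact_linl w)) //.
  exact: bilin_scalel.
split=> [h f v lf w|h v w]; first by rewrite e // h linear0.
by apply: tensor_eq0l => f lf; rewrite -e // h.
Qed.

Lemma kills2_slicer M N t : kills2 M N t <->
  forall (f : N -> K^o) (w : N), linear f ->
    kills M (tlift (fun a1 a2 => (f (hact a2 w) : K) *: a1) t).
Proof.
have e (f : N -> K^o) v w : linear f ->
    hact (tlift (fun a1 a2 => (f (hact a2 w) : K) *: a1) t) v =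
    tlift (fun (u : M) w => (f w : K) *: u)
      (tlift (fun a1 a2 => tens (hact a1 v) (hact a2 w)) t).
  move=> lf; rewrite (tlift_comp _ _ (hact_linl v)) tlift_tlift.
  apply: eq_tlift => a1 a2; rewrite tlift_tens ?(linear_funZ _ _ (hact_linl v)) //.
  exact: bilin_scaler.
split=> [h f v lf w|h v w]; first by rewrite e // h linear0.
by apply: tensor_eq0r => f lf; rewrite -e // h.
Qed.

Lemma ann_sub_tensorr M N N' :
  ann_sub N N' -> ann_sub (tensor_module M N) (tensor_module M N').
Proof.
move=> NN' x; rewrite !kills_tensorP !kills2_slicel => h f v lf.
by apply: NN'; exact: h.
Qed.

Lemma ann_sub_tensorA V M N : ann_sub (tensor_module V (tensor_module M N))
  (tensor_module (tensor_module V M) N).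
Proof.
move=> x; rewrite !kills_tensorP => h s w.
pose G s := tlift (fun a1 a2 => tens (@hact _ _ (tensor_module V M) a1 s) (hact a2 w)) (comul x).
have lG : linear G.
  apply: tlift_linear_param => a1 a2; apply: bilin_tensl.
  exact: (@hact_linr _ _ (tensor_module V M)).
apply: (@tensor_ext _ V M _ G (fun=> 0)) => // [c y z|v m]; first by rewrite scaler0 addr0.
(* [R] rebrackets the tensors; coassociativity makes it compatible with the actions. *)
pose R := fun (v : V) (r : tensor M N) => tlift (fun m n => tens (tens v m) n) r.
have bt (n : N) : bilin (fun (v : V) (m : M) => tens (tens v m) n).
  by split=> [m'|v']; [exact: bilin_tensl n ((tens_bilin V M).1 m')
                      |exact: bilin_tensl n ((tens_bilin V M).2 v')].
have bt' (v' : V) : bilin (fun (m : M) (n : N) => tens (tens v' m) n).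
  split=> [n'|m']; first exact: bilin_tensl n' ((tens_bilin V M).2 v').
  exact: ((tens_bilin (tensor V M) N).2 (tens v' m')).
have bR : bilin R.
  by split=> [r|u]; [apply: tlift_linear_param => m' n'; exact: ((bt n').1 m')
                    |exact: tlift_linear].
have /(congr1 (tlift R)) := h v (tens m w).
rewrite linear0 tlift_tlift => <-; rewrite /G.
transitivity (tlift (fun a1 a2 => tlift (fun b c =>
    tens (tens (hact b v) (hact c m)) (hact a2 w)) (comul a1)) (comul x)).
  apply: eq_tlift => a1 a2 /=; rewrite tens_actE (tlift_comp _ _ ((tens_bilin (tensor V M) N).1 _)).
  by apply: eq_tlift.
rewrite (@comul_coassoc _ (fun a b c => tens (tens (hact a v) (hact b m)) (hact c w))).
- apply: eq_tlift => a1 a2; rewrite tlift_tens //= tens_actE /R tlift_tlift.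
  by apply: eq_tlift => b c; rewrite tlift_tens.
- move=> a; exact: bilin_comp (bt' _) (hact_linl m) (hact_linl w).
- move=> b c d y z; rewrite (hact_linl v); exact: (bt _).1.
Qed.

(** * Iterated tensor products and the coideal property *)

Section Powers.
Variable V : hmodule H.

(** Bracketed so that one factor [V] comes off at a time, which matches one multiplication by the
    character matrix. *)
Fixpoint tensor_iter m N : hmodule H :=
  if m is m'.+1 then tensor_module V (tensor_iter m' N) else N.

Lemma tensor_iter_power m n :
  tensor_iter m (tensor_power V n) = tensor_power V (m + n).
Proof. by elim: m => //= m ->. Qed.

Lemma ann_sub_iter m N :
  ann_sub (tensor_iter m N) (tensor_module (tensor_power V m) N).
Proof.
elim: m => [|m IH] /=.
  move=> x xN; apply/kills_tensorP => c w /=.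
  have := bilin_tensr c (hact_linl w); set g := fun _ => _ => lg.
  transitivity (g (tlift (fun a1 a2 => counit a1 *: a2) (comul x))).
    rewrite (tlift_comp _ _ lg); apply: eq_tlift => a1 a2.
    rewrite (linear_funZ _ _ lg) /g.
    by rewrite (linear_funZ _ _ ((tens_bilin K^o N).1 (hact a2 w))).
  by rewrite counit_comull /g xN (linear_fun0 ((tens_bilin _ _).2 _)).
apply: ann_sub_trans (ann_sub_tensorr IH) _; exact: ann_sub_tensorA.
Qed.

Lemma ann_sub_power_add m n : ann_sub (tensor_power V (m + n))
  (tensor_module (tensor_power V m) (tensor_power V n)).
Proof. by rewrite -tensor_iter_power; exact: ann_sub_iter. Qed.

(** The tensor square of [H/J] acts faithfully on the sum of all [V^m] tensor [V^n]. Slices of the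
    second leg kill every [V^m], so they lie in [J] and vanish under [p]; the argument is then
    repeated on the other leg. *)
Lemma kills2_powers (J : {vspace H}) t :
  (forall x, x \in J <-> forall m, kills (tensor_power V m) x) ->
  (forall m n, kills2 (tensor_power V m) (tensor_power V n) t) ->
  t \in (tens_vs J {:H} + tens_vs {:H} J)%VS.
Proof.
move=> JP h; apply: tens_vs_coker; pose p (x : H) := x - projv J x.
have lp : linear p.
  by move=> c x y; rewrite /p linearP /= opprD addrACA scalerBr.
have p0 x : x \in J -> p x = 0 by move=> xJ; rewrite /p projv_id ?subrr.
have step1 n (w : tensor_power V n) :
    tlift (fun a1 a2 => tens (p a1) (hact a2 w)) t = 0.
  apply: tensor_eq0r => f lf; rewrite tlift_tlift.
  transitivity (p (tlift (fun a1 a2 => (f (hact a2 w) : K) *: a1) t)).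
    rewrite (tlift_comp _ _ lp); apply: eq_tlift => a1 a2.
    by rewrite tlift_tens ?(linear_funZ _ _ lp) //; exact: bilin_scaler.
  by apply/p0/JP => m; apply: (kills2_slicer _ _ _).1.
apply: tensor_eq0l => f lf; rewrite tlift_tlift.
transitivity (p (tlift (fun a1 a2 => (f (p a1) : K) *: a2) t)).
  rewrite (tlift_comp _ _ lp); apply: eq_tlift => a1 a2.
  by rewrite tlift_tens ?(linear_funZ _ _ lp) //; exact: bilin_scalel.
apply/p0/JP => n w; rewrite (tlift_comp _ _ (hact_linl w)).
have := congr1 (tlift (fun u (w : tensor_power V n) => (f u : K) *: w)) (step1 n w).
rewrite linear0 tlift_tlift => <-; apply: eq_tlift => a1 a2.
by rewrite tlift_tens ?(linear_funZ _ _ (hact_linl w)) //; exact: bilin_scalel.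
Qed.

End Powers.

(* Convolution [f |-> id * f] is injective, with left inverse [f |-> S * f], and preserves
   the space of endomorphisms mapping [J] to [J]; by finiteness of dimension it is onto that
   space, which therefore contains the preimage [S] of [x |-> counit x *: 1]. *)
Lemma biideal_antipode (J : {vspace H}) :
  (forall a x : H, x \in J -> a * x \in J /\ x * a \in J) ->
  (forall x : H, x \in J -> comul x \in (tens_vs J {:H} + tens_vs {:H} J)%VS) ->
  (forall x : H, x \in J -> counit x = 0) ->
  forall x : H, x \in J -> antipode x \in J.
Proof.
move=> Jideal Jcoideal Jcounit.
pose T0 (f : 'Hom(H, H)) (x : H) := tlift (fun a1 a2 => a1 * f a2) (comul x).
have lT0 f : linear (T0 f) by move=> c x y; rewrite /T0 comul_linear linearP.
pose T := linfun (fun f => linfun (T0 f)).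
have TE f x : T f x = T0 f x.
  rewrite linfunE ?(linfunE (lT0 _)) // => c g h; apply/lfunP => y.
  rewrite lfunE /= lfunE /= !(linfunE (lT0 _)) /T0.
  pose F (f : 'Hom(H, H)) a1 a2 := a1 * f a2.
  have := @tlift_linear_param H H H 'Hom(H, H) F (comul y) _; apply=> a b d f1 f2.
  by rewrite /F lfunE /= lfunE /= mulrDr scalerAr.
have Tinj (f g : 'Hom(H, H)) : T f = T g -> f = g.
  move=> e; apply/lfunP => x.
  (* In Sweedler notation, [S(x1) x2 f'(x3) = f'(x)]. *)
  suff inv (f' : 'Hom(H, H)) : f' x = tlift (fun a1 a2 => antipode a1 * T f' a2) (comul x).
    by rewrite (inv f) (inv g) e.
  transitivity (tlift (fun a1 a2 =>
      antipode a1 * tlift (fun b c => b * f' c) (comul a2)) (comul x)); last first.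
    by apply: eq_tlift => a1 a2; rewrite TE.
  transitivity (tlift (fun a1 a2 =>
      tlift (fun b c => antipode b * (c * f' a2)) (comul a1)) (comul x)).
    rewrite -[in LHS](counit_comull x).
    have lf : linear f' by move=> c y z; rewrite linearP.
    rewrite (tlift_comp _ _ lf); apply: eq_tlift => a1 a2.
    rewrite linearZ /=.
    have lm : linear (fun a : H => a * f' a2) by exact: (mul_bilin H).1.
    transitivity (tlift (fun b c => antipode b * c) (comul a1) * f' a2).
      by rewrite antipodel -scalerAl mul1r.
    by rewrite (tlift_comp _ _ lm); apply: eq_tlift => b c; rewrite mulrA.
  rewrite (@comul_coassoc _ (fun a b c => antipode a * (b * f' c))).
  - apply: eq_tlift => a1 a2.
    have lm : linear (fun a : H => antipode a1 * a) by exact: (mul_bilin H).2.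
    by rewrite (tlift_comp _ _ lm).
  - move=> a; split=> [w|u] c y z.
      by rewrite mulrDl mulrDr -scalerAl -scalerAr.
    by rewrite linearP /= !mulrDr -!scalerAr.
  - by move=> b c d y z; rewrite antipode_linear mulrDl -scalerAl.
have [||W WP] := @vspace_of_pred K 'Hom(H, H) (fun f => forall x, x \in J -> f x \in J).
- by move=> x _; rewrite zero_lfunE mem0v.
- by move=> c f g fJ gJ x xJ; rewrite lfunE /= lfunE /= rpredD ?rpredZ ?fJ ?gJ.
have TW : (T @: W <= W)%VS.
  apply/subvP => _ /memv_imgP[f /WP fJ ->]; apply/WP => x /Jcoideal.
  rewrite TE /T0 => /memv_addP[s sJ [s' s'J ->]]; rewrite linearD /=.
  have mem (P Q : {vspace H}) r : (forall u w, u \in P -> w \in Q -> u * f w \in J) ->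
      r \in tens_vs P Q -> tlift (fun a1 a2 => a1 * f a2) r \in J.
    move=> PQ rPQ; pose L := linfun (tlift (fun a1 a2 => a1 * f a2)).
    have LE := linfunE (tlift_linear (fun a1 a2 => a1 * f a2)).
    suff : r \in (L @^-1: J)%VS by rewrite -memv_preim LE.
    apply: (subvP _ _ rPQ); apply/span_subvP => _ /allpairsP[[u w] /= [uP wQ ->]].
    rewrite -memv_preim LE tlift_tens; first by apply: PQ; exact: vbasis_mem.
    by split=> [w'|u'] c y z; rewrite ?linearP ?mulrDl ?mulrDr -?scalerAl -?scalerAr.
  apply: rpredD.
    by apply: mem sJ => u w uJ _; case: (Jideal (f w) _ uJ).
  by apply: mem s'J => u w _ wJ; case: (Jideal u _ (fJ _ wJ)).
have eTW : (T @: W == W)%VS.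
  rewrite eqEdim TW limg_dim_eq ?leqnn //.
  apply/eqP; rewrite -subv0; apply/subvP => f.
  by rewrite memv_cap memv_ker memv0 => /andP[_ /eqP Tf]; apply/eqP/Tinj; rewrite Tf linear0.
have lS : linear (antipode : H -> H) := @antipode_linear K H.
pose S := linfun (antipode : H -> H).
have SE : S =1 antipode := linfunE lS.
have : T S \in (T @: W)%VS.
  rewrite (eqP eTW); apply/WP => x xJ; rewrite TE /T0.
  rewrite (eq_tlift (g := fun a1 a2 => a1 * antipode a2)); last by move=> a1 a2; rewrite SE.
  by rewrite antipoder Jcounit // scale0r mem0v.
by move=> /memv_imgP[f /WP fJ /Tinj eS] x /fJ; rewrite -eS SE.
Qed.

Lemma tpow_ann_kills V x : x \in tpow_ann V <-> forall m, kills (tensor_power V m) x.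
Proof. exact: tpow_annP. Qed.

(** If [x] kills [V^(m+n)], then [comul x] kills [V^m] tensor [V^n], whence the coideal property;
    the power 0 handles the counit. *)
Lemma tpow_ann_hopf_ideal V : hopf_ideal (tpow_ann V).
Proof.
have ideal (a x : H) : x \in tpow_ann V -> a * x \in tpow_ann V /\ x * a \in tpow_ann V.
  move=> /tpow_ann_kills xV; split; apply/tpow_ann_kills => m;
    by have [_ _ mul] := kills_ideal (tensor_power V m); case: (mul a x (xV m)).
have coideal x : x \in tpow_ann V ->
    comul x \in (tens_vs (tpow_ann V) {:H} + tens_vs {:H} (tpow_ann V))%VS.
  move=> /tpow_ann_kills xV; apply: (@kills2_powers V); first exact: tpow_ann_kills.
  by move=> m n; apply/kills_tensorP/ann_sub_power_add.
have co1 x : x \in tpow_ann V -> counit x = 0.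
  by move=> /tpow_ann_kills/(_ 0%N (1 : K^o)) /= /eqP; rewrite scaler_eq0 oner_eq0 orbF => /eqP.
by split=> //; exact: biideal_antipode.
Qed.

End HopfLemmas.

(** * Composition factors of tensor powers *)

Lemma fset_set_seq (T : choiceType) (A : set T) (s : seq T) : uniq s ->
  (forall x, A x <-> x \in s) -> finite_set A /\ #|` fset_set A|%fset = size s.
Proof.
move=> us As; have -> : A = [set` seq_fset tt s]%classic.
  by apply/seteqP; split => x; rewrite /mkset seq_fsetE; case: (As x).
split; first exact: finite_fset.
by rewrite set_fsetK size_seq_fset undup_id.
Qed.

Lemma expr_gcdn_eq1 (F : fieldType) (z : F) a b :
  z ^+ a = 1 -> z ^+ b = 1 -> z ^+ gcdn a b = 1.
Proof.
move=> za zb; have [->|a0] := posnP a; first by rewrite gcd0n.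
case: (egcdnP b a0) => ka kb e _.
have: z ^+ (ka * a) = 1 by rewrite mulnC exprM za expr1n.
by rewrite e exprD mulnC exprM zb expr1n mul1r.
Qed.

(** [h] is the least positive gcd of a finite list from [D]; a further [d] cannot lower it, so [h]
    divides [d]. The last clause ranges over all fields because it serves both for [K] and for the
    complex numbers. *)
Lemma nat_set_gcd (D : nat -> Prop) d0 : D d0 -> (0 < d0)%N ->
  exists2 h, (0 < h)%N & (forall d, D d -> (h %| d)%N) /\
    forall (F : fieldType) (z : F), (forall d, D d -> z ^+ d = 1) -> z ^+ h = 1.
Proof.
move=> Dd0 d0_gt0.
pose P n := `[< (0 < n)%N /\ exists2 s : seq nat,
  (forall d, d \in s -> D d) & \big[gcdn/0%N]_(d <- s) d = n >].
have exP : exists n, P n.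
  exists d0; apply/asboolP; split=> //; exists [:: d0]; last by rewrite big_seq1.
  by move=> d; rewrite inE => /eqP->.
case: (ex_minnP exP) => h /asboolP[h0 [s sD hs]] hmin; exists h => //; split.
  move=> d Dd; have /hmin hle : P (gcdn d h).
    apply/asboolP; split; first by rewrite gcdn_gt0 h0 orbT.
    exists (d :: s); last by rewrite big_cons hs.
    by move=> e; rewrite inE => /orP[/eqP->|/sD].
  have /eqP <- : gcdn d h == h by rewrite eqn_leq hle dvdn_leq ?dvdn_gcdr.
  exact: dvdn_gcdl.
move=> F z zD; rewrite -hs big_seq.
elim/big_ind: _ => [||d /sD/zD//]; [exact: expr0|exact: expr_gcdn_eq1].
Qed.

(** In characteristic zero [X^h - 1] is separable, so it has [h] distinct roots, and a group of [h]
    roots of unity contains a primitive one. *)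
Lemma closed_prim_root (F : closedFieldType) h : [pchar F] =i pred0 -> (0 < h)%N ->
  exists z : F, h.-primitive_root z.
Proof.
move=> charF h0; pose p := 'X^h - 1 : {poly F}.
have [r pr] := closed_field_poly_normal p.
have mp : p \is monic by exact: monicXnsubC.
rewrite (monicP mp) scale1r in pr.
have sepp : separable_poly p.
  by rewrite /p separable_Xn_sub_1 // ((pcharf0P F).1 charF) -lt0n.
have ur : uniq r by rewrite -separable_prod_XsubC -pr.
have sr : size r = h.
  by have := size_prod_XsubC r id; rewrite -pr size_XnsubC // => -[].
have /hasP[z _ hz] : has h.-primitive_root r.
  apply: cyclic.has_prim_root; rewrite ?sr //; apply/allP => z zr.
  by rewrite /root_of_unity -/p pr root_prod_XsubC.
by exists z.
Qed.

(** * Simple factors of a family of modules *)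

Section FamilyFactor.
Variables (K : fieldType) (A : falgType K) (M : nat -> hmodule A) (Q : hmodule A).
Hypothesis sQ : simple_module Q.

Lemma not_kills1 : ~ kills Q 1.
Proof.
have [v v0] := simple_nonzero sQ => /(_ v) /eqP.
by rewrite hact1 (negPf v0).
Qed.

(** A prime ideal containing a finite intersection of ideals contains one of them. *)
Lemma finite_family_factor (s : seq nat) :
  (forall x, (forall m, m \in s -> kills (M m) x) -> kills Q x) ->
  exists2 m, m \in s & ann_sub (M m) Q.
Proof.
elim: s => [|m s IH] h; first by case: not_kills1; apply: h.
have [mQ|nmQ] := pselect (ann_sub (M m) Q); first by exists m; rewrite ?mem_head.
have [y [ym yQ]] : exists y, kills (M m) y /\ ~ kills Q y.
  by apply: contrapT => h'; apply: nmQ => y ym; apply: contrapT => yQ; apply: h'; exists y.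
have [|m' m's m'Q] := IH; last by exists m'; rewrite // inE m's orbT.
move=> x xs; have [a|//|/yQ//] := @simple_prime _ _ Q x y sQ.
apply: h => m'; rewrite inE => /orP[/eqP->|/xs xm'].
  by have [_ _ mul] := kills_ideal (M m); case: (mul (x * a) _ ym).
have [_ _ mul] := kills_ideal (M m'); rewrite -mulrA; by case: (mul (a * y) _ xm').
Qed.

(** A finite subfamily whose common annihilator has least dimension has the same annihilator as the
    whole family, which reduces to the finite case. *)
Lemma family_factor (P : nat -> Prop) :
  (forall x, (forall m, P m -> kills (M m) x) -> kills Q x) ->
  exists2 m, P m & ann_sub (M m) Q.
Proof.
move=> h.
have /choice[U UP] m : exists U : {vspace A}, forall x, x \in U <-> kills (M m) x.
  by have [k0 klin _] := kills_ideal (M m); exact: vspace_of_pred.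
pose I s := (\bigcap_(m <- s) U m)%VS.
have IP s x : x \in I s <-> forall m, m \in s -> kills (M m) x.
  rewrite /I; elim: s => [|m s IH]; first by rewrite big_nil memvf.
  rewrite big_cons memv_cap; split=> [/andP[/UP xm /IH xs] m'|xs].
    by rewrite inE => /orP[/eqP->|/xs].
  apply/andP; split; first by apply/UP/xs/mem_head.
  by apply/IH => m' m's; apply: xs; rewrite inE m's orbT.
pose R n := `[< exists2 s : seq nat, (forall m, m \in s -> P m) & \dim (I s) = n >].
have exR : exists n, R n by exists (\dim (I [::])); apply/asboolP; exists [::].
case: (ex_minnP exR) => n /asboolP[s sP ds] nmin.
have [|m ms mQ] := @finite_family_factor s; last by exists m => //; exact: sP.
move=> x /IP xs; apply: h => m Pm; apply/UP.
have /nmin : R (\dim (I (m :: s))).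
  apply/asboolP; exists (m :: s) => // m'; rewrite inE => /orP[/eqP->//|]; exact: sP.
rewrite -ds => dle; have sub : (I (m :: s) <= I s)%VS by rewrite /I big_cons capvSr.
have /eqP e : (I (m :: s) == I s)%VS by rewrite eqEdim sub.
by move: xs; rewrite -e /I big_cons memv_cap => /andP[].
Qed.

End FamilyFactor.

(** * Return times and scalar grouplikes for faithful tensor powers *)

Section Faithful.
Variables (K : fieldType) (L : hopfAlgType K) (V : hmodule L).
Hypothesis faithful : forall x, (forall m, kills (tensor_power V m) x) -> x = 0.
Local Notation triv := (trivial_module L).

Lemma trivial_simple : simple_module triv.
Proof.
split=> [e|U hU].
  have : (1 : K^o) \in {:triv}%VS by exact: memvf.
  by rewrite e memv0 oner_eq0.
have [->|/eqP U0] := pselect (U = 0%VS); [by left|right].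
have u0 : (vpick U : K^o) != 0 by rewrite vpick0.
apply/eqP; rewrite eqEsubv subvf; apply/subvP => v _.
have -> : v = ((v : K) / (vpick U : K)) *: vpick U by rewrite -[RHS]/(_ * _) divfK.
by rewrite memvZ // memv_pick.
Qed.

(** The first power is [V] tensor the trivial module; slicing off the trivial leg leaves the counit
    axiom. *)
Lemma ann_sub_power1 : ann_sub (tensor_power V 1) V.
Proof.
move=> x /kills_tensorP/kills2_slicer/(_ id (1 : K^o)) h.
have {h} : kills V (tlift (fun a1 a2 => counit a2 *: a1) (comul x)).
  move=> v; rewrite -[RHS](h _ v) //; congr hact; apply: eq_tlift => a1 a2 /=.
  by congr (_ *: _); rewrite [RHS]mulr1.
by rewrite counit_comulr.
Qed.

Lemma simple_factor_of_power Q : simple_module Q -> exists m, ann_sub (tensor_power V m) Q.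
Proof.
move=> sQ; have [|m _ mQ] := family_factor (M := tensor_power V) sQ (P := fun=> True).
  by move=> x xV; rewrite (faithful (fun m => xV m I)) => v; rewrite (linear_fun0 (hact_linl v)).
by exists m.
Qed.

(* If [x] kills every [V^m (x) N] then [x1 (x) x2 n = 0] by faithfulness, hence
   [counit x *: n = S(x1) x2 n = 0]. *)
Lemma trivial_factor (N : hmodule L) : {:N}%VS <> 0%VS ->
  exists m, ann_sub (tensor_module (tensor_power V m) N) triv.
Proof.
move=> /nonzero_vector[n n0].
have [|m _ mQ] := family_factor (M := fun m => tensor_module (tensor_power V m) N)
    trivial_simple (P := fun=> True); last by exists m.
move=> x xV.
have x0 : tlift (fun a1 a2 => tens a1 (hact a2 n)) (comul x) = 0.
  apply: tensor_eq0r => f lf; rewrite tlift_tlift; apply: faithful => m.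
  have /kills_tensorP/kills2_slicer/(_ f n lf) := xV m I.
  congr kills; apply: eq_tlift => a1 a2; rewrite tlift_tens //.
  exact: bilin_scaler.
have bS : bilin (fun (a : L) (w : N) => hact (antipode a) w).
  by apply: (bilin_comp (h := id) (hact_bilin N)) => //; exact: antipode_linear.
have := congr1 (tlift (fun a w => hact (antipode a) w)) x0.
rewrite linear0 tlift_tlift => e.
have: hact (tlift (fun a1 a2 => antipode a1 * a2) (comul x)) n = 0.
  rewrite -[RHS]e (tlift_comp _ _ (hact_linl n)); apply: eq_tlift => a1 a2.
  by rewrite tlift_tens // hactM.
rewrite antipodel (linear_funZ _ _ (hact_linl n)) hact1 => /eqP.
rewrite scaler_eq0 (negPf n0) orbF => /eqP x00 v.
by rewrite /= x00 scale0r.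
Qed.

Definition return_time d : Prop := exists m, exists2 Q : hmodule L, simple_module Q &
  ann_sub (tensor_power V m) Q /\ ann_sub (tensor_power V (m + d)) Q.

(** The trivial module is [V^0] and also a factor of some [V^(m+1)], so [m + 1] is a return time.
    Positivity matters, as 0 always is one. *)
Lemma return_time_ex : {:V}%VS <> 0%VS -> exists2 d, return_time d & (0 < d)%N.
Proof.
move=> V0; have V10 : {:tensor_power V 1}%VS <> 0%VS.
  move=> e; have [v v0] := nonzero_vector V0.
  have: tens v (1 : K^o) \in {:tensor_power V 1}%VS by exact: memvf.
  by rewrite e memv0 => /eqP/(tens_eq0 v0)/eqP; rewrite oner_eq0.
have [m mt] := trivial_factor V10; exists (m + 1)%N; last by rewrite addn1.
exists 0%N, triv; first exact: trivial_simple.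
split=> //; rewrite add0n; apply: ann_sub_trans mt; exact: ann_sub_power_add.
Qed.

Lemma common_factor_return_time m n Q : simple_module Q ->
  ann_sub (tensor_power V m) Q -> ann_sub (tensor_power V n) Q ->
  (m <= n)%N -> return_time (n - m).
Proof. by move=> sQ mQ nQ mn; exists m, Q; rewrite // subnKC. Qed.

Lemma scalar_ext x y (c : nat -> K) :
  (forall m (t : tensor_power V m), hact x t = c m *: t) ->
  (forall m (t : tensor_power V m), hact y t = c m *: t) -> x = y.
Proof.
move=> hx hy; apply/eqP; rewrite -subr_eq0; apply/eqP/faithful => m t.
by rewrite (linear_funB _ _ (hact_linl t)) hx hy subrr.
Qed.

Lemma grouplike_power g xi : grouplike g -> (forall v : V, hact g v = xi *: v) ->
  forall m (t : tensor_power V m), hact g t = xi ^+ m *: t.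
Proof.
move=> [gg g1] gV; elim=> [|m IH] t; first by rewrite /= g1 expr0.
apply: (@tensor_ext _ V (tensor_power V m) _ (tens_act g) (fun t => xi ^+ m.+1 *: t)).
- exact: (tens_act_bilin V (tensor_power V m)).2.
- by move=> d x y; rewrite scalerDr !scalerA mulrC.
move=> v s; rewrite tens_actE gg tlift_tens; last first.
  by apply: bilin_comp (tens_bilin _ _) _ _; exact: hact_linl.
rewrite gV IH exprS.
rewrite (linear_funZ _ _ ((tens_bilin _ _).1 _)) (linear_funZ _ _ ((tens_bilin _ _).2 _)).
by rewrite scalerA.
Qed.

(** Both [comul g] and [tens g g] act on [V^m] tensor [V^n] by [z ^+ (m + n)], hence they
    coincide. *)
Lemma scalar_grouplike g z : (forall m (t : tensor_power V m), hact g t = z ^+ m *: t) ->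
  scalar_grouplikes V g.
Proof.
move=> gV; split; last first.
  by exists z; apply/killsP/ann_sub_power1/killsP; exact: gV 1%N.
split; last by have /eqP := gV 0%N (1 : K^o); rewrite expr0 /= => /eqP; rewrite scale1r [LHS]mulr1.
apply/eqP; rewrite -subr_eq0 -memv0 -tens_vs0; apply: (@kills2_powers _ _ V).
  move=> x; rewrite memv0; split=> [/eqP-> m t|/faithful->//].
  exact: linear_fun0 (hact_linl t).
move=> m n v w; rewrite linearB /= tlift_tens; last first.
  by apply: bilin_comp (tens_bilin _ _) _ _; exact: hact_linl.
rewrite !gV (linear_funZ _ _ ((tens_bilin _ _).1 _)) (linear_funZ _ _ ((tens_bilin _ _).2 _)).
rewrite scalerA -exprD -tens_actE.
have /killsP/ann_sub_power_add/killsP h := gV (m + n)%N.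
by apply/eqP; rewrite subr_eq0; apply/eqP; exact: h (tens v w).
Qed.

(** [g] acts on each power by a scalar, so it commutes there with every [x]; faithfulness
    concludes. *)
Lemma scalar_grouplike_center g : scalar_grouplikes V g -> g \in 'Z({:L})%VS.
Proof.
move=> [gg [xi gV]]; rewrite memv_cap memvf; apply/centvP => x _.
have gt := grouplike_power gg gV.
apply/eqP; rewrite -subr_eq0; apply/eqP/faithful => m t.
rewrite (linear_funB _ _ (hact_linl t)) !hactM !gt.
by rewrite (linear_funZ _ _ (hact_linr x)) subrr.
Qed.

(** On a common factor of [V^m] and [V^(m+d)] the scalars [xi ^+ m] and [xi ^+ (m + d)] agree. *)
Lemma scalar_grouplike_root g xi d : {:V}%VS <> 0%VS -> grouplike g ->
  (forall v : V, hact g v = xi *: v) -> return_time d -> xi ^+ d = 1.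
Proof.
move=> V0 gg gV [m [Q sQ [mQ dQ]]]; have gt := grouplike_power gg gV.
have [q q0] := simple_nonzero sQ.
have /killsP/mQ/killsP/(_ q) e1 := gt m.
have /killsP/dQ/killsP/(_ q) := gt (m + d)%N.
rewrite e1 => /eqP; rewrite -subr_eq0 -scalerBl scaler_eq0 (negPf q0) orbF.
rewrite exprD -[X in X - _]mulr1 -mulrBr mulf_eq0 subr_eq0 => /orP[|/eqP//].
(* The case [xi = 0] is excluded because [g] has the inverse [antipode g] and [V] is nonzero. *)
rewrite expf_eq0 => /andP[_ /eqP xi0]; have [v v0] := nonzero_vector V0.
have [cg eg] := gg; have := antipoder g.
rewrite cg eg scale1r tlift_tens; last first.
  apply: (bilin_comp (g := id) (mul_bilin L)) => //; exact: antipode_linear.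
move=> e; case/eqP: v0; rewrite -[v]hact1 -e hactM gV xi0 scale0r //.
Qed.

Section Period.
Variable h : nat.
Hypotheses (h_gt0 : (0 < h)%N) (h_dvd : forall d, return_time d -> (h %| d)%N).

(* The annihilators of [(+)_(m = r mod h) V^m], [r < h], are pairwise comaximal since a
   common simple factor for [r] and [s] would give a return time congruent to [r - s]. *)
Lemma period_element z : z ^+ h = 1 ->
  exists g : L, forall m (t : tensor_power V m), hact g t = z ^+ m *: t.
Proof.
move=> zh; pose J r x := forall m, (m %% h)%N = r -> kills (tensor_power V m) x.
have idJ r : two_sided_ideal (J r).
  (* The congruence on [m] moves into the index type, so that [ideal_forall] applies. *)
  have : two_sided_ideal
      (fun x => forall m : {m | (m %% h)%N = r}, kills (tensor_power V (sval m)) x).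
    by apply: ideal_forall => m; exact: kills_ideal.
  congr two_sided_ideal; apply/funext => x; apply/propext; split=> hx m; last exact: hx (svalP m).
  by move=> mr; exact: hx (exist _ m mr).
have sep r s : r != s -> exists2 x, J r x & J s (1 - x).
  move=> rs; have [//|[Q sQ [rQ sQ']]] := comaximal_or_common_factor (idJ r) (idJ s).
  have [m mr mQ] := family_factor sQ rQ.
  have [n ns nQ] := family_factor sQ sQ'.
  case/eqP: rs; rewrite -mr -ns; apply/eqP => {mr ns}.
  wlog mn : m n mQ nQ / (m <= n)%N => [wl|].
    by case/orP: (leq_total m n) => ?; [exact: wl|rewrite eq_sym; exact: (wl n m)].
  by rewrite eq_sym eqn_mod_dvd //; apply: h_dvd; exact: common_factor_return_time sQ mQ nQ mn.
have /choice[e he] r : exists e, J r (1 - e) /\ forall s, (s < h)%N -> s != r -> J s e.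
  have [t|e e1 e0] := ideal_crt (I := J r) (s := [seq s <- iota 0 h | s != r]) (idJ r) idJ.
    by rewrite mem_filter => /andP[tr _]; apply: sep; rewrite eq_sym.
  by exists e; split=> // s sh sr; apply: e0; rewrite mem_filter sr mem_iota.
(* [e r] acts as 1 on the powers congruent to [r] modulo [h] and as 0 on the others. *)
exists (\sum_(r < h) z ^+ r *: e r) => m t.
rewrite (linear_fun_sum _ _ _ (hact_linl t)).
rewrite (bigD1 (Ordinal (ltn_pmod m h_gt0))) //= big1 => [|r rm].
  have [e1 _] := he (m %% h)%N; rewrite (linear_funZ _ _ (hact_linl t)).
  have /killsP -> : kills (tensor_power V m) (e (m %% h)%N - 1 *: 1).
    rewrite scale1r => s; rewrite -opprB -scaleN1r (linear_funZ _ _ (hact_linl s)).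
    by rewrite (e1 _ erefl) scaler0.
  by rewrite scale1r addr0 expr_mod.
have [_ /(_ (m %% h)%N (ltn_pmod _ h_gt0))] := he r.
rewrite eq_sym => /(_ rm)/(_ _ erefl) h0.
by rewrite (linear_funZ _ _ (hact_linl t)) h0 scaler0.
Qed.

End Period.
End Faithful.

(** * The peripheral spectrum of a nonnegative matrix *)

Section PerronFrobenius.
Variables (C : numClosedFieldType) (k : nat) (A : 'M[nat]_k) (d : 'I_k -> nat) (n : nat).
Hypotheses (d_gt0 : forall i, (0 < d i)%N) (n_gt0 : (0 < n)%N).
Hypothesis dA : forall j, (\sum_i A i j * d i = n * d j)%N.
Let B : 'M[C]_k := map_mx (fun m => m%:R) A.

Lemma natr_neq0 m : (0 < m)%N -> m%:R != 0 :> C.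
Proof. by rewrite pnatr_eq0 lt0n. Qed.

(** [eigenvalue] refers to row vectors. By [dA], [d] is one for [n]; twisting it entrywise by [w]
    multiplies the eigenvalue by [zeta]. *)
Lemma twisted_eigenvalue (w : 'I_k -> C) (zeta : C) (i0 : 'I_k) : w i0 != 0 ->
  (forall i j, (A i j != 0)%N -> w i = zeta * w j) -> eigenvalue B (n%:R * zeta).
Proof.
move=> w0 wA; apply/eigenvalueP; exists (\row_i ((d i)%:R * w i)).
  apply/rowP => j; rewrite !mxE.
  rewrite (eq_bigr (fun i => (A i j * d i)%:R * (zeta * w j))).
    by rewrite -mulr_suml -natr_sum dA natrM; ring.
  move=> i _; rewrite !mxE natrM; have [->|/wA->] := eqVneq (A i j) 0%N.
    by rewrite mulr0 !mul0r.
  by rewrite mulrAC [_ * (A i j)%:R]mulrC.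
apply/eqP => /rowP/(_ i0); rewrite !mxE => /eqP.
by rewrite mulf_eq0 (negPf w0) orbF (negPf (natr_neq0 (d_gt0 i0))).
Qed.

(* Write a left eigenvector as [d i * w i] and look at a column [j] where [|w j|] is
   maximal: [dA] is then the equality case of the triangle inequality. *)
Lemma eigenvalue_bound mu : eigenvalue B mu -> `|mu| <= n%:R /\
  (`|mu| = n%:R -> exists (w : 'I_k -> C) (j0 : 'I_k), w j0 != 0 /\
     forall i j, `|w j| = `|w j0| -> (A i j != 0)%N -> w i = mu / n%:R * w j).
Proof.
move=> /eigenvalueP[v vB v0].
have [i0 vi0] : exists i, v 0 i != 0.
  apply/existsP; rewrite -negb_forall; apply: contra v0 => /forallP v0.
  by apply/eqP/rowP => i; rewrite mxE (eqP (v0 i)).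
have [w dw] : exists w : 'I_k -> C, forall i, v 0 i = (d i)%:R * w i.
  by exists (fun i => v 0 i / (d i)%:R) => i; rewrite mulrC divfK // natr_neq0.
have [j0 _ w_max] := @real_arg_maxP C 'I_k i0 predT (fun i => `|w i|) isT
  (fun i _ => normr_real (w i)).
have w_le i : `|w i| <= `|w j0| by exact: w_max.
have wj0 : w j0 != 0.
  rewrite -normr_gt0; apply: lt_le_trans (w_le i0); rewrite normr_gt0.
  by apply: contraNneq vi0 => w0; rewrite dw w0 mulr0.
have col j : \sum_i (A i j * d i)%:R * w i = mu * ((d j)%:R * w j).
  have /rowP/(_ j) := vB; rewrite !mxE -dw => <-; apply: eq_bigr => i _.
  by rewrite !mxE dw natrM; ring.
have le_col j i : true -> `|(A i j * d i)%:R * w i| <= (A i j * d i)%:R * `|w j0|.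
  by rewrite normrM normr_nat ler_wpM2l ?ler0n.
have sum_col j : \sum_i (A i j * d i)%:R * `|w j0| = n%:R * ((d j)%:R * `|w j0|).
  by rewrite -mulr_suml -natr_sum dA natrM mulrA.
split.
  have : `|mu * ((d j0)%:R * w j0)| <= n%:R * ((d j0)%:R * `|w j0|).
    rewrite -col -sum_col; apply: le_trans (ler_norm_sum _ _ _) _.
    by apply: ler_sum => i _; exact: (le_col j0 i).
  rewrite !normrM normr_nat ler_pM2r //.
  by rewrite mulr_gt0 ?ltr0n ?normr_gt0.
move=> mun; exists w, j0; split=> // i j wj Aij.
have eq_col : `|\sum_i (A i j * d i)%:R * w i| = \sum_i (A i j * d i)%:R * `|w j0|.
  by rewrite col sum_col !normrM normr_nat mun wj.
have sum_norm : \sum_i `|(A i j * d i)%:R * w i| = \sum_i (A i j * d i)%:R * `|w j0|.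
  apply/le_anti; rewrite -{2}eq_col ler_norm_sum andbT.
  by apply: ler_sum => i' _; exact: (le_col j i').
have norm_eq := normC_sum_upper (fun l h => eq_ind_r (fun x => x <= _) (le_col j l h)
  (normr_id _)) sum_norm.
(* In the equality case all terms share one phase [t], and each attains its upper bound. *)
have [t _ ht'] := normC_sum_eq (etrans eq_col (esym sum_norm)).
have ht l : true -> (A l j * d l)%:R * w l = (A l j * d l)%:R * `|w j0| * t.
  by move=> _; rewrite ht' // norm_eq.
have wi l : (A l j != 0)%N -> w l = `|w j0| * t.
  move=> Al; have /eqP := ht l isT; rewrite -mulrA.
  rewrite (inj_eq (mulfI _)); first by move/eqP.
  by rewrite natr_neq0 // muln_gt0 lt0n Al d_gt0.
(* The column equation identifies the common value [|w j0| t] as [mu / n] times [w j]. *)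
have := col j; rewrite (eq_bigr _ ht) -mulr_suml sum_col => e.
have dj : (d j)%:R != 0 :> C by exact: natr_neq0.
have n0 : n%:R != 0 :> C by exact: natr_neq0.
apply: (mulfI (mulf_neq0 n0 dj)); rewrite wi //.
transitivity (mu * ((d j)%:R * w j)); first by rewrite -e; ring.
by field.
Qed.

End PerronFrobenius.

(** * The group of scalar grouplikes *)

Section FaithfulGroup.
Variables (K : closedFieldType) (L : hopfAlgType K) (V : hmodule L).
Hypothesis charK : [pchar K] =i pred0.
Hypothesis faithful : forall x, (forall m, kills (tensor_power V m) x) -> x = 0.

Lemma power_unit (g : L) h : (0 < h)%N -> g ^+ h = 1 ->
  g \is a GRing.unit /\ forall z : int, exists n : nat, g ^ z = g ^+ n.
Proof.
move=> h0 gh; have gV : g * g ^+ h.-1 = 1 by rewrite -exprS prednK.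
have gV' : g ^+ h.-1 * g = 1 by rewrite -exprSr prednK.
have ug : g \is a GRing.unit by apply/unitrP; exists (g ^+ h.-1).
split=> // -[n|n]; first by exists n.
(* [Negz n] is [-(n+1)], and the inverse of [g] is [g ^+ h.-1]. *)
exists (h.-1 * n.+1)%N; rewrite NegzE -exprnN -exprVn exprM; congr (_ ^+ _).
by apply: (mulrI ug); rewrite gV mulrV.
Qed.

(** Only the power 0 is nonzero, so by faithfulness an element is determined by its counit. *)
Lemma scalar_grouplikes_zero : {:V}%VS = 0%VS -> forall g, scalar_grouplikes V g <-> g = 1.
Proof.
move=> V0 g; have V0m m (t : tensor_power V m.+1) : t = 0.
  rewrite -[t]tlift_id; apply: tlift_eq0 => v w.
  have -> : v = 0 by apply/eqP; rewrite -memv0 -V0 memvf.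
  exact: linear_fun0 ((tens_bilin _ _).1 w).
split=> [[[_ eg] _]|->].
  apply: (scalar_ext faithful (c := fun=> 1)) => m t; last by rewrite hact1 scale1r.
  case: m t => [|m] t; first by rewrite /= eg.
  by rewrite (V0m m t) (linear_fun0 (hact_linr _)) scaler0.
split; first by split; [exact: comul1|exact: counit1].
by exists 1 => v; rewrite hact1 scale1r.
Qed.

(** The generator [g] acts on [V^m] by [z ^+ m] for a primitive [h]-th root [z]. The scalar of any
    member is a power of [z] and determines it; since [V] is nonzero, the [h] powers of [g] are
    distinct. *)
Lemma scalar_grouplikes_period h : {:V}%VS <> 0%VS -> (0 < h)%N ->
  (forall d, return_time V d -> (h %| d)%N) ->
  (forall (F : fieldType) (z : F), (forall d, return_time V d -> z ^+ d = 1) -> z ^+ h = 1) ->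
  cyclic_group (scalar_grouplikes V) /\
  (finite_set (scalar_grouplikes V) /\ #|` fset_set (scalar_grouplikes V)|%fset = h).
Proof.
move=> V0 h0 h_dvd h_root; have [z hz] := closed_prim_root charK h0.
have [g gV] := period_element h0 h_dvd (prim_expr_order hz).
have gX n m (t : tensor_power V m) : hact (g ^+ n) t = (z ^+ n) ^+ m *: t.
  elim: n => [|n IH]; first by rewrite expr0 expr1n hact1 scale1r.
  rewrite exprS hactM IH (linear_funZ _ _ (hact_linr g)) gV scalerA -exprMn.
  by rewrite exprSr.
have gh : g ^+ h = 1.
  apply: (scalar_ext faithful (c := fun=> 1)) => m t; last by rewrite hact1 scale1r.
  by rewrite gX (prim_expr_order hz) expr1n.
have GVX n : scalar_grouplikes V (g ^+ n) by exact: (scalar_grouplike faithful (gX n)).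
have GVP x : scalar_grouplikes V x -> exists i : 'I_h, x = g ^+ i.
  move=> [gx [xi xV]]; have xi_h : xi ^+ h = 1.
    by apply: h_root => d; exact: scalar_grouplike_root V0 gx xV.
  have [i xi_i] := prim_rootP hz xi_h; exists i.
  apply: (scalar_ext faithful (c := fun m => (z ^+ i) ^+ m)) => m t; last exact: gX.
  by rewrite (grouplike_power gx xV) xi_i.
split.
  have [ug gZ] := power_unit h0 gh; exists g => //; apply/seteqP; split=> x.
    by move=> /GVP[i ->]; exists (i : nat).
  by move=> [y _ <-]; have [n ->] := gZ y.
have [v v0] := nonzero_vector V0.
have := @fset_set_seq _ (scalar_grouplikes V) [seq g ^+ (i : nat) | i : 'I_h].
rewrite size_map size_enum_ord; apply.
  rewrite map_inj_uniq ?enum_uniq // => i j eij; apply: val_inj => /=.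
  have e n : hact (g ^+ n) v = z ^+ n *: v.
    have /killsP/ann_sub_power1/killsP := gX n 1%N; exact.
  have /eqP := e i; rewrite eij e -subr_eq0 -scalerBl scaler_eq0 (negPf v0) orbF subr_eq0.
  by rewrite eq_sym (eq_prim_root_expr hz) !modn_small // => /eqP.
move=> x; split=> [/GVP[i ->]|/mapP[i _ ->]]; last exact: GVX.
by apply: map_f; rewrite mem_enum.
Qed.

End FaithfulGroup.

(** * Multiplicativity of characters *)

Section TensorCharacter.
Variables (K : fieldType) (L : hopfAlgType K).
Implicit Types M N : hmodule L.

Lemma conv_linearr (f : 'Hom(L, K^o)) : linear (conv f).
Proof.
move=> c g g'; apply/lfunP => a; rewrite lfunE /= lfunE /= !convE.
pose F (g : 'Hom(L, K^o)) a1 a2 := f a1 * g a2 : K^o.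
have := @tlift_linear_param K L L K^o 'Hom(L, K^o) F (comul a) _; apply=> u w b g1 g2.
by rewrite /F lfunE /= lfunE /= mulrDr scalerAr.
Qed.

Lemma character_tensor M N :
  character (tensor_module M N) = conv (character M) (character N).
Proof.
apply/lfunP => a; rewrite convE.
pose b := vbasis {:M}; pose c := vbasis {:N}.
pose u (p : 'I_(\dim {:M}) * 'I_(\dim {:N})) : tensor_module M N := tens b`_p.1 c`_p.2.
pose phi (p : 'I_(\dim {:M}) * 'I_(\dim {:N})) (t : tensor_module M N) : K^o :=
  (t : tensor M N) p.1 p.2.
rewrite (@character_dual _ _ _ _ u phi).
- transitivity (\sum_(p : 'I_(\dim {:M}) * 'I_(\dim {:N})) tlift (fun a1 a2 =>
      coord b p.1 (hact a1 b`_p.1) * coord c p.2 (hact a2 c`_p.2) : K^o) (comul a)).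
    apply: eq_bigr => -[i j] _; rewrite /phi /u /= tens_actE.
    rewrite (@tlift_comp _ _ _ _ K^o (fun t : tensor M N => t i j)); last first.
      by move=> d x y; rewrite !mxE.
    by apply: (@eq_tlift _ _ _ K^o) => a1 a2; rewrite mxE.
  rewrite /tlift exchange_big; apply: eq_bigr => i _ /=.
  rewrite exchange_big; apply: eq_bigr => j _ /=.
  rewrite -scaler_sumr; congr (_ *: _); rewrite !characterE.
  rewrite big_distrl /= -(pair_big xpredT xpredT (fun i' j' =>
    coord b i' (hact (vbasis {:L})`_i b`_i') * coord c j' (hact (vbasis {:L})`_j c`_j'))) /=.
  by apply: eq_bigr => i' _; rewrite big_distrr.
- by move=> p d x y; rewrite /phi !mxE.
- move=> t; rewrite -[t in LHS]tlift_id /tlift.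
  by rewrite -(pair_big xpredT xpredT (fun i j => phi (i, j) t *: u (i, j))).
Qed.

End TensorCharacter.

(** * The index of imprimitivity *)

Section CharacterMatrix.
Variables (K : fieldType) (L : hopfAlgType K) (V : hmodule L).
Hypothesis charK : [pchar K] =i pred0.
Hypothesis faithful : forall x, (forall m, kills (tensor_power V m) x) -> x = 0.
Variables (k : nat) (chi : k.-tuple 'Hom(L, K^o)).
Hypothesis chi_irr : perm_eq chi (irr_chars L).

Lemma mem_irr_chars (f : 'Hom(L, K^o)) :
  f \in irr_chars L <-> exists2 M : hmodule L, simple_module M & f = character M.
Proof.
rewrite /irr_chars in_fset_set; last exact: finite_irreducible_characters.
by rewrite inE.
Qed.

Lemma chi_uniq : uniq chi.
Proof. by rewrite (perm_uniq chi_irr) fset_uniq. Qed.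

Lemma chi_free : free chi.
Proof.
apply: (irreducible_characters_free charK chi_uniq) => f.
by rewrite (perm_mem chi_irr) => /mem_irr_chars.
Qed.

Lemma chi_basis : basis_of (char_ring L) chi.
Proof. by rewrite /basis_of chi_free andbT; apply/eqP/eq_span/perm_mem. Qed.

Lemma chi_modules : exists T : 'I_k -> hmodule L, forall i,
  simple_module (T i) /\ tnth chi i = character (T i).
Proof.
have /choice[T hT] i : exists M : hmodule L, simple_module M /\ tnth chi i = character M.
  have : tnth chi i \in irr_chars L by rewrite -(perm_mem chi_irr) mem_tnth.
  by move=> /mem_irr_chars[M sM ->]; exists M.
by exists T.
Qed.

Lemma chi_coord_inj (a b : 'I_k -> nat) :
  \sum_i (a i)%:R *: tnth chi i = \sum_i (b i)%:R *: tnth chi i -> forall i, a i = b i.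
Proof.
move=> /eqP; rewrite -subr_eq0 -sumrB => /eqP e i; apply: (natr_inj charK).
apply/eqP; rewrite -subr_eq0; apply/eqP.
have /freeP/(_ (fun i => (a i)%:R - (b i)%:R)) h := chi_free.
apply: h; rewrite -[RHS]e; apply: eq_bigr => j _.
by rewrite scalerBl (tnth_nth 0).
Qed.

Variable T : 'I_k -> hmodule L.
Hypotheses (T_simple : forall i, simple_module (T i))
           (chi_T : forall i, tnth chi i = character (T i)).

Lemma chi_inj : injective (fun i => character (T i)).
Proof.
move=> i j; rewrite -!chi_T !(tnth_nth 0) => /eqP.
by rewrite nth_uniq ?size_tuple ?chi_uniq // => /eqP/val_inj.
Qed.

Lemma chi_complete Q : simple_module Q -> exists i, character Q = character (T i).
Proof.
move=> sQ; have : character Q \in chi.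
  by rewrite (perm_mem chi_irr); apply/mem_irr_chars; exists Q.
by move=> /tnthP[i ->]; exists i.
Qed.

Lemma multiplicities M : exists n : 'I_k -> nat,
  character M = \sum_i (n i)%:R *: tnth chi i /\
  forall i, (n i != 0)%N <-> ann_sub M (T i).
Proof.
have [n [en hn]] := composition_multiplicities charK M T_simple chi_inj chi_complete.
by exists n; split=> //; rewrite en; apply: eq_bigr => i _; rewrite chi_T.
Qed.

Lemma multiplicity_neq0 M (n : 'I_k -> nat) i :
  character M = \sum_i (n i)%:R *: tnth chi i -> (n i != 0)%N <-> ann_sub M (T i).
Proof.
have [n' [en' hn']] := multiplicities M.
by rewrite en' => /chi_coord_inj <-.
Qed.

Lemma lmul_matrix_ex : exists A : 'M[nat]_k, lmul_matrix (character V) chi A.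
Proof.
have /choice[n hn] j : exists n : 'I_k -> nat,
    conv (character V) (tnth chi j) = \sum_i (n i)%:R *: tnth chi i.
  have [n [en _]] := multiplicities (tensor_module V (T j)).
  by exists n; rewrite chi_T -character_tensor.
exists (\matrix_(i, j) n j i) => j; rewrite hn; apply: eq_bigr => i _.
by rewrite mxE.
Qed.

Variable A : 'M[nat]_k.
Hypothesis hA : lmul_matrix (character V) chi A.

Lemma matrix_neq0 i j : (A i j != 0)%N <-> ann_sub (tensor_module V (T j)) (T i).
Proof.
by apply: (multiplicity_neq0 (n := fun i => A i j)); rewrite character_tensor -chi_T hA.
Qed.

(** Evaluating the matrix equation at 1 shows that the dimension vector is a left eigenvector. *)
Lemma matrix_dim j : (\sum_i A i j * \dim {:T i} = \dim {:V} * \dim {:T j})%N.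
Proof.
apply: (natr_inj charK); rewrite natr_sum natrM -!character1.
have := congr1 (fun f : 'Hom(L, K^o) => f 1) (hA j).
rewrite chi_T convE comul1 tlift_tens; last first.
  by split=> [w|u] c x y; rewrite linearP /= ?mulrDl ?mulrDr -?scalerAl -?scalerAr.
move=> ->; rewrite sum_lfunE; apply: eq_bigr => i _.
by rewrite lfunE /= chi_T !character1 natrM.
Qed.

(** Expand [N] into irreducibles first: the coefficients are natural numbers, so nothing cancels and
    some term must be nonzero. *)
Lemma tensor_factor N i : ann_sub (tensor_module V N) (T i) ->
  exists2 l, ann_sub N (T l) & (A i l != 0)%N.
Proof.
have [n [en hn]] := multiplicities N.
pose c i := (\sum_l n l * A i l)%N.
have /multiplicity_neq0 <- : character (tensor_module V N) = \sum_i (c i)%:R *: tnth chi i.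
  rewrite character_tensor en (linear_fun_sum _ _ _ (conv_linearr _)).
  transitivity (\sum_l \sum_i (n l * A i l)%:R *: tnth chi i).
    apply: eq_bigr => l _; rewrite (linear_funZ _ _ (conv_linearr _)) hA scaler_sumr.
    by apply: eq_bigr => i' _; rewrite scalerA natrM.
  rewrite exchange_big; apply: eq_bigr => i' _ /=.
  by rewrite -scaler_suml natr_sum.
rewrite sum_nat_eq0 negb_forall => /existsP[l]; rewrite /= muln_eq0 negb_or => /andP[nl Al].
by exists l => //; apply/hn.
Qed.

Lemma ann_sub_iter_mono m N N' : ann_sub N N' ->
  ann_sub (tensor_iter V m N) (tensor_iter V m N').
Proof. by move=> NN'; elim: m => //= m IH; exact: ann_sub_tensorr. Qed.

Lemma ann_sub_T i j : ann_sub (T i) (T j) -> i = j.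
Proof.
move=> h; apply: chi_inj; apply/eq_characterP => //; exact: T_simple.
Qed.

Lemma dim_T_gt0 i : (0 < \dim {:T i})%N.
Proof. by rewrite lt0n dimv_eq0; apply/eqP; case: (T_simple i). Qed.

(** * Walks along the nonzero entries of the matrix *)

Section Twist.
Variables (C : fieldType) (zeta : C).

(** The relation on [w] is available only in columns satisfying [P], such as those of maximal
    modulus, so [P] travels along with it. *)
Lemma propagate (w : 'I_k -> C) (P : 'I_k -> Prop) :
  (forall i j, P j -> (A i j != 0)%N -> P i /\ w i = zeta * w j) ->
  forall m i j, P j -> ann_sub (tensor_iter V m (T j)) (T i) -> P i /\ w i = zeta ^+ m * w j.
Proof.
move=> wA m; elim: m => [|m IH] i j Pj /=.
  by move/ann_sub_T <-; rewrite expr0 mul1r.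
move=> /tensor_factor[l jl Ail]; have [Pl wl] := IH l j Pj jl.
by have [Pi wi] := wA i l Pl Ail; rewrite wi wl mulrA -exprS.
Qed.

(** The trivial character is reached from [j0]. From there a common factor of [V^m] and [V^(m+d)] is
    reached in [m] and in [m + d] steps, and the two values of [w] must agree. *)
Lemma propagate_root (w : 'I_k -> C) (P : 'I_k -> Prop) j0 : zeta != 0 ->
  (forall i, P i -> w i != 0) ->
  (forall i j, P j -> (A i j != 0)%N -> P i /\ w i = zeta * w j) ->
  P j0 -> forall d, return_time V d -> zeta ^+ d = 1.
Proof.
move=> zeta0 w0 wA Pj0 d [m [Q sQ [mQ dQ]]].
have [t et] := chi_complete (trivial_simple L).
have trivT : ann_sub (trivial_module L) (T t).
  exact/(eq_characterP charK (trivial_simple L) (T_simple t)).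
have Ttriv : ann_sub (T t) (trivial_module L).
  exact: ann_sub_simple_sym (trivial_simple L) (T_simple t) trivT.
have [m0 m0t] := trivial_factor faithful (proj1 (T_simple j0)).
have [Pt _] : P t /\ w t = zeta ^+ m0 * w j0.
  apply: (propagate wA Pj0); apply: ann_sub_trans trivT.
  by apply: ann_sub_trans m0t; exact: ann_sub_iter.
have [i ei] := chi_complete sQ.
have QT : ann_sub Q (T i) by exact/(eq_characterP charK sQ (T_simple i)).
have iterT l : ann_sub (tensor_power V l) Q -> w i = zeta ^+ l * w t.
  move=> lQ; have [//|_ //] := propagate wA Pt (m := l) (i := i).
  apply: ann_sub_trans QT; apply: ann_sub_trans lQ.
  apply: ann_sub_trans (@ann_sub_iter_mono l _ _ Ttriv) _.
  by rewrite -[trivial_module L]/(tensor_power V 0) tensor_iter_power addn0.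
have := iterT _ mQ; rewrite (iterT _ dQ) exprD => /(mulIf (w0 t Pt))/eqP.
by rewrite -[X in _ == X]mulr1 (inj_eq (mulfI _)) ?expf_neq0 // => /eqP.
Qed.

(** Set [w i = zeta ^+ m] for any [V^m] having [T i] as a factor; two choices of [m] differ by a
    return time, a multiple of [h]. *)
Lemma twist_ex h : (forall d, return_time V d -> (h %| d)%N) -> zeta ^+ h = 1 ->
  exists w : 'I_k -> C, (forall i, exists m, w i = zeta ^+ m) /\
    forall i j, (A i j != 0)%N -> w i = zeta * w j.
Proof.
move=> h_dvd zh.
have /choice[m hm] i : exists m, ann_sub (tensor_power V m) (T i).
  exact: (simple_factor_of_power faithful).
have eq_pow a b i : ann_sub (tensor_power V a) (T i) -> ann_sub (tensor_power V b) (T i) ->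
    zeta ^+ a = zeta ^+ b.
  wlog ab : a b / (a <= b)%N => [wl ha hb|].
    by case/orP: (leq_total a b) => ?; [exact: wl|apply/esym/wl].
  move=> ha hb; rewrite -(subnKC ab) exprD.
  have /dvdnP[q ->] := h_dvd _ (common_factor_return_time (T_simple i) ha hb ab).
  by rewrite mulnC exprM zh expr1n mulr1.
exists (fun i => zeta ^+ m i); split=> [i|i j]; first by exists (m i).
rewrite -exprS => /matrix_neq0 Aij; apply: eq_pow (hm i) _.
exact: ann_sub_trans (ann_sub_tensorr (hm j)) Aij.
Qed.

End Twist.

(** * Counting the peripheral eigenvalues *)

Section Index.
Variable R : realType.

(** The matrix is zero and nonempty, since the trivial character exists; its only eigenvalue 0
    counts once. *)
Lemma imprimitivity_index_zero : {:V}%VS = 0%VS -> imprimitivity_index R A = 1%N.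
Proof.
move=> V0; have A0 i j : A i j = 0%N.
  apply/eqP; apply: contraT => /matrix_neq0 h.
  case: (@not_kills1 _ _ (T i) (T_simple i)); apply: h => s.
  rewrite hact1 -[s]tlift_id; apply: tlift_eq0 => v w.
  have -> : v = 0 by apply/eqP; rewrite -memv0 -V0 memvf.
  exact: linear_fun0 ((tens_bilin _ _).1 w).
have B0 : cmatrix R A = 0 by apply/matrixP => i j; rewrite !mxE A0.
have [t _] := chi_complete (trivial_simple L).
have evP mu : eigenvalue (cmatrix R A) mu <-> mu = 0.
  split=> [/eigenvalueP[v]|->].
    by rewrite B0 mulmx0 => /esym/eqP; rewrite scaler_eq0 => /orP[/eqP//|->].
  apply/eigenvalueP; exists (const_mx 1); first by rewrite B0 mulmx0 scale0r.
  by apply/eqP => /rowP/(_ t); rewrite !mxE => /eqP; rewrite oner_eq0.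
rewrite /imprimitivity_index.
have [|mu|_ ->] := @fset_set_seq _ [set mu : R[i] | eigenvalue (cmatrix R A) mu /\
  exists2 lam, perron_eigenvalue A lam & `|mu| = lam]%classic [:: 0] => //.
rewrite inE; split=> [[/evP->]|/eqP->]; first by rewrite eqxx.
split; first exact/evP; exists 0; last by rewrite normr0.
by split=> // [|nu /evP->]; [exact/evP|rewrite normr0].
Qed.

Lemma imprimitivity_index_period h : {:V}%VS <> 0%VS -> (0 < h)%N ->
  (forall d, return_time V d -> (h %| d)%N) ->
  (forall (F : fieldType) (z : F), (forall d, return_time V d -> z ^+ d = 1) -> z ^+ h = 1) ->
  imprimitivity_index R A = h.
Proof.
move=> V0 h0 h_dvd h_root.
have n0 : (0 < \dim {:V})%N by rewrite lt0n dimv_eq0; exact/eqP.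
set n := \dim {:V} in n0.
have nC : n%:R != 0 :> R[i] by rewrite pnatr_eq0 -lt0n.
have [z hz] := @closed_prim_root R[i] h (@pchar_num _) h0.
have [t _] := chi_complete (trivial_simple L).
have bound := @eigenvalue_bound R[i] _ _ _ _ dim_T_gt0 n0 matrix_dim.
have ev zeta : zeta ^+ h = 1 -> eigenvalue (cmatrix R A) (n%:R * zeta).
  move=> zh; have [w [wpow wA]] := twist_ex h_dvd zh.
  apply: (twisted_eigenvalue dim_T_gt0 matrix_dim (w := w) (i0 := t)) => //.
  have [m ->] := wpow t; apply/expf_neq0/eqP => z0; move: zh.
  by move/eqP; rewrite z0 expr0n gtn_eqF // eq_sym oner_eq0.
have norm1 (zeta : R[i]) : zeta ^+ h = 1 -> `|zeta| = 1.
  by move=> zh; apply/eqP; rewrite -(@pexpr_eq1 _ _ h) // -normrX zh normr1.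
have perron_n : perron_eigenvalue A (n%:R : R[i]).
  split; rewrite ?ler0n //; last by move=> mu /bound[].
  by have := ev 1 (expr1n _ _); rewrite mulr1.
(* The index quantifies over Perron eigenvalues; this fixes the radius as [n]. *)
have perron_uniq (lam : R[i]) : perron_eigenvalue A lam -> lam = n%:R.
  move=> [lam_ev lam0 lam_max]; have [evn _ n_max] := perron_n.
  apply/le_anti/andP; split.
    by have := n_max _ lam_ev; rewrite ger0_norm.
  by have := lam_max _ evn; rewrite normr_nat.
rewrite /imprimitivity_index.
have [||_ ->] := @fset_set_seq _ [set mu : R[i] | eigenvalue (cmatrix R A) mu /\
  exists2 lam, perron_eigenvalue A lam & `|mu| = lam]%classic
  [seq n%:R * z ^+ (i : nat) | i : 'I_h]; last by rewrite size_map size_enum_ord.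
  rewrite map_inj_uniq ?enum_uniq // => i j /(mulfI nC)/eqP.
  by rewrite (eq_prim_root_expr hz) !modn_small // => /eqP/val_inj.
move=> mu; split=> [[mu_ev [lam /perron_uniq-> mu_n]]|/mapP[i _ ->]]; last first.
  have zih : (z ^+ i) ^+ h = 1 by rewrite exprAC (prim_expr_order hz) expr1n.
  split; first exact: ev.
  by exists n%:R => //; rewrite normrM normr_nat norm1 // mulr1.
have [_ /(_ mu_n)[w [j0 [wj0 wA]]]] := bound mu mu_ev.
have zeta1 : `|mu / n%:R| = 1 by rewrite normrM normfV mu_n normr_nat divff.
have zeta0 : mu / n%:R != 0 by rewrite -normr_eq0 zeta1 oner_eq0.
have zh : (mu / n%:R) ^+ h = 1.
  (* [P] selects the entries of maximal modulus, preserved because [mu / n] has modulus 1. *)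
  apply: h_root; apply: (propagate_root (w := w) (P := fun i => `|w i| = `|w j0|) (j0 := j0)) => //.
    by move=> i wi; rewrite -normr_eq0 wi normr_eq0.
  move=> i j wj Aij; have wi := wA i j wj Aij.
  by rewrite {1}wi normrM zeta1 mul1r.
have [i ei] := prim_rootP hz zh.
have -> : mu = n%:R * z ^+ i by rewrite -ei mulrC divfK.
by apply: map_f; rewrite mem_enum.
Qed.

End Index.
End CharacterMatrix.

(** * Passage to the quotient *)

Section QuotientPowers.
Variables (K : fieldType) (H : hopfAlgType K) (V : hmodule H).
Variable hJ : hopf_ideal (tpow_ann V).
Local Notation VL := (quot_module hJ (@tpow_ann_act K H V)).

Lemma tmap_tens (U W U' W' : vectType K) (f : U -> U') (g : W -> W') u w :
  linear f -> linear g -> tmap f g (tens u w) = tens (f u) (g w).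
Proof. by move=> lf lg; apply: tlift_tens; exact: bilin_comp (tens_bilin _ _) lf lg. Qed.

(** The two powers are modules over different algebras, so [f] is built by recursion to be
    compatible with the actions through [hpi]. *)
Lemma quot_power m : exists (f : tensor_power V m -> tensor_power VL m)
    (g : tensor_power VL m -> tensor_power V m),
  [/\ linear f, linear g, cancel f g
    & forall x t, f (hact x t) = hact (hpi hJ x) (f t)].
Proof.
elim: m => [|m [f [g [lf lg fK fa]]]].
  exists id, id; split=> // x t /=; congr (_ *: _).
  by rewrite -[RHS]/(hq_counit (hpi hJ x)) hq_counit_pi.
have lid (U : vectType K) : linear (id : U -> U) by [].
pose f' : tensor V (tensor_power V m) -> tensor VL (tensor_power VL m) :=
  tmap (id : V -> VL) f.
pose g' : tensor VL (tensor_power VL m) -> tensor V (tensor_power V m) :=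
  tmap (id : VL -> V) g.
have lf' : linear f' := tmap_linear _ _.
have lg' : linear g' := tmap_linear _ _.
exists f', g'; split=> //.
  apply: tensor_ext => [c y z||v t]; [by rewrite lf' lg'|by []|].
  by rewrite /f' /g' tmap_tens // tmap_tens // fK.
move=> x; pose F1 t := f' (tens_act x t); pose F2 t := tens_act (V := VL) (hpi hJ x) (f' t).
suff : F1 =1 F2 by [].
apply: tensor_ext => [c y z|c y z|v t]; rewrite /F1 /F2.
- by rewrite (tens_act_bilin _ _).2 lf'.
- by rewrite lf' (tens_act_bilin _ _).2.
rewrite tens_actE (tlift_comp _ _ lf') [in RHS]/f' tmap_tens // tens_actE.
rewrite -[comul (hpi hJ x)]/(hq_comul (hpi hJ x)) hq_comul_pi tlift_tmap; last first.
  by apply: bilin_comp (tens_bilin _ _) _ _; exact: hact_linl.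
apply: eq_tlift => a1 a2; rewrite /f' tmap_tens // fa; congr tens.
exact: esym (hq_act_pi hJ (@tpow_ann_act K H V) a1 v).
Qed.

Lemma quot_faithful (q : hquot hJ) :
  (forall m, kills (tensor_power VL m) (q : (hquot hJ : hopfAlgType K))) -> q = 0.
Proof.
have [x ->] := hpi_surj q => xV; apply: hpi0; apply/tpow_ann_kills => m t.
have [f [g [lf lg fK fa]]] := quot_power m.
by rewrite -[LHS]fK fa xV (linear_fun0 lg).
Qed.

End QuotientPowers.
Local Open Scope classical_set_scope.

Theorem theorem5p4 (R : realType) (K : closedFieldType) (H : hopfAlgType K)
    (V : hmodule H) :
  [pchar K] =i pred0 ->
  semisimple_algebra H ->
  exists hJ : hopf_ideal (tpow_ann V),
  let L := hquot hJ : hopfAlgType K in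
  let VL := quot_module hJ (@tpow_ann_act K H V) : hmodule L in
  let GV := scalar_grouplikes VL in
  [/\ cyclic_group GV,
      forall g : L, GV g -> g \in 'Z({:L})%VS,
      finite_set GV
    & forall (k : nat) (chi : k.-tuple 'Hom(L, K^o)),
        perm_eq chi (irr_chars L) ->
        [/\ basis_of (char_ring L) chi,
            exists A : 'M[nat]_k, lmul_matrix (character VL) chi A
          & forall A : 'M[nat]_k, lmul_matrix (character VL) chi A ->
              imprimitivity_index R A = #|` fset_set GV|%fset]].
Proof.
move=> charK _; exists (tpow_ann_hopf_ideal V) => L VL GV.
have faithful (x : L) : (forall m, kills (tensor_power VL m) x) -> x = 0.
  exact: quot_faithful.
(* One [h], fixed before any list of characters, is both the group order and the index; it is 1 for
   [V = 0] and the gcd of the return times otherwise. *)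
have [h [[GVcyc [GVfin GVcard]] ind]] : exists h,
    (cyclic_group GV /\ (finite_set GV /\ #|` fset_set GV|%fset = h)) /\
    forall k (chi : k.-tuple 'Hom(L, K^o)) T A, perm_eq chi (irr_chars L) ->
      (forall i, simple_module (T i)) -> (forall i, tnth chi i = character (T i)) ->
      lmul_matrix (character VL) chi A -> imprimitivity_index R A = h.
  have [V0|V0] := pselect ({:VL}%VS = 0%VS).
    have GV1 := scalar_grouplikes_zero faithful V0.
    exists 1%N; split.
      split; last first.
        apply: (fset_set_seq (s := [:: 1])) => // x; rewrite inE.
        by split=> [/GV1->|/eqP->]; [exact: eqxx|exact/GV1].
      exists 1; first exact: unitr1.
      apply/seteqP; split=> x; first by move=> /GV1->; exists 0; rewrite ?expr0z.
      by move=> [z _ <-]; apply/GV1; rewrite exp1rz.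
    move=> k chi T A chi_irr sT chiT hA.
    exact: (imprimitivity_index_zero charK chi_irr sT chiT hA R V0).
  have [d Dd d0] := return_time_ex faithful V0.
  have [h h0 [h_dvd h_root]] := nat_set_gcd Dd d0.
  exists h; split; first exact: scalar_grouplikes_period.
  move=> k chi T A chi_irr sT chiT hA.
  exact: (imprimitivity_index_period charK faithful chi_irr sT chiT hA R V0 h0 h_dvd h_root).
split=> // [g GVg|k chi chi_irr]; first exact: scalar_grouplike_center faithful g GVg.
have [T hT] := chi_modules charK chi_irr.
have sT i := (hT i).1; have chiT i := (hT i).2.
split.
- exact: chi_basis.
- exact: (lmul_matrix_ex VL charK chi_irr sT chiT).
- by move=> A hA; rewrite GVcard; exact: ind chi_irr sT chiT hA.
Qed.
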